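(* Let $H$ be a finite set of connected fully commutative permutations each of whose heaps contains at least two entries in each internal column, or let $H=\emptyset$. Suppose $$F(x)=\sum_{n\ge 0}\bigl|S_{n+1}^{\{[321]\}}(H)\bigr|\,x^n,\qquad L(x)=F(x)-xF(x)-1,\qquad M(x)=F(x)-2xF(x)+x^2F(x)-1 .$$ Then $$\sum_{n\ge 0}\bigl|S_{n+1}^{\{[3421],[4231],[4312],[4321]\}}(H)\bigr|\,x^n = F(x)+\frac{L(x)^2}{1-M(x)}$$ and $$\sum_{n\ge 0}\bigl|S_{n+1}^{\{[3421],[4312],[4321]\}}(H)\bigr|\,x^n = F(x)+\frac{L(x)^2}{1-x-M(x)} .$$
   Context: The symmetric group $S_n$ is generated by the adjacent transpositions $s_1,\dots,s_{n-1}$, with $s_i=(i\;\,i+1)$. Reduced expressions for $w$ are words in the $s_i$ of minimal length representing $w$; $\mathrm{supp}(w)$ is the set of generators occurring in any (equivalently every) reduced expression of $w$. A permutation $w\in S_n$ is connected if the subscripts of the generators in $\mathrm{supp}(w)$ form a nonempty interval in $\{1,\dots,n-1\}$. Two reduced expressions of $w$ lie in the same commutativity class if they differ by a sequence of moves $s_is_j\mapsto s_js_i$ with $|i-j|\ge 2$; $w$ is fully commutative if it has exactly one commutativity class. Heaps: for a reduced expression $\mathsf w=\mathsf w_1\cdots\mathsf w_k$, the heap of $\mathsf w$ is the poset on $\{1,\dots,k\}$ given by the transitive closure of: $a\prec b$ if $a<b$ and $\mathsf w_a$ does not commute with $\mathsf w_b$, with element $a$ labeled by $\mathsf w_a$.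 Up to labeled isomorphism it depends only on the commutativity class; a fully commutative permutation has a unique heap. Entries labeled $s_i$ form column $i$. If $w$ is fully commutative and connected with $\mathrm{supp}(w)=\{s_i,s_{i+1},\dots,s_j\}$, then columns $i+1,\dots,j-1$ are the internal columns of the heap of $w$ and columns $i$ and $j$ are its extremal columns. Heap containment: an orientation preserving Coxeter embedding $f:\{s_1,\dots,s_{k-1}\}\to\{s_1,\dots,s_{n-1}\}$ is an injective map such that for each $m\in\{2,3\}$, $(s_is_j)^m=1$ if and only if $(f(s_i)f(s_j))^m=1$, and such that the subscript of $f(s_i)$ is less than that of $f(s_j)$ whenever $i<j$; it is applied letterwise to words. A permutation $w\in S_n$ heap-contains $h\in S_k$ if there are commutativity classes of $w$ and $h$, represented by reduced expressions $\mathsf w$ and $\mathsf h$, and such an $f$ for which the heap of $f(\mathsf h)$ is contained as a convex labeled subposet of the heap of $\mathsf w$ (a subposet $Q$ of $P$ is convex if $x<y<z$ in $P$ with $x,z\in Q$ implies $y\in Q$). Otherwise $w$ heap-avoids $h$. For a set $P$ of permutations, $S_{n}^{P}(H)$ denotes the set of $w\in S_{n}$ that avoid every $p\in P$ as a classical (one-line) permutation pattern and that heap-avoid every $h\in H$. The constant term of $F(x)$ is defined to be $1$, corresponding to the empty heap.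
   Formalization: The Coxeter embedding f is required only on supp(h), not on all of s_1,…,s_{k-1} (else H={s_1 in S_3} fails); and any H having a member with exactly two columns but none with exactly one column is excluded, since the formulas then fail at x^2. *)

(* Defs.v *)
From HB Require Import structures.
From Stdlib Require Import Relation_Operators.
From mathcomp Require Import all_boot all_order all_algebra all_fingroup.
From mathcomp Require Import finmap boolp.

Set Implicit Arguments.
Unset Strict Implicit.
Unset Printing Implicit Defensive.

(** * The symmetric group as a Coxeter group

   The group $S_{n+1}$ is ['S_n.+1], acting on {0,...,n}; its generators
   s_1,...,s_n are indexed from 0 by ['I_n].  Words are multiplied with the
   group law of [{perm _}], which composes from left to right.  Composing from
   right to left instead would replace every permutation by its inverse, in
   [w] and in [h] alike. *)

Section Coxeter.
Variable n : nat.
Implicit Types (w : 'S_n.+1) (u v : seq 'I_n) (i j : 'I_n).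

Definition gen i : 'S_n.+1 := tperm (widen_ord (leqnSn n) i) (lift ord0 i).

Definition word_perm u : 'S_n.+1 := (\prod_(i <- u) gen i)%g.

Definition reduced w u : Prop :=
  word_perm u = w /\ forall v, word_perm v = w -> size u <= size v.

Definition supp w : {set 'I_n} := [set i | `[< exists2 u, reduced w u & i \in u >]].

Definition gen_interval i j : {set 'I_n} := [set c : 'I_n | i <= c <= j].

Definition connected w : Prop :=
  exists i j : 'I_n, i <= j /\ supp w = gen_interval i j.

Inductive comm_move : seq 'I_n -> seq 'I_n -> Prop :=
  CommMove u v i j of (i.+1 < j) || (j.+1 < i) :
    comm_move (u ++ [:: i, j & v]) (u ++ [:: j, i & v]).

Definition comm_equiv : seq 'I_n -> seq 'I_n -> Prop :=
  clos_refl_trans _ comm_move.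

Definition fully_commutative w : Prop :=
  forall u v, reduced w u -> reduced w v -> comm_equiv u v.

(** ** Heaps: the heap of [u] is the poset ['I_(size u)] *)

Definition label u (a : 'I_(size u)) : 'I_n := tnth (in_tuple u) a.

Definition heap_rel u : rel 'I_(size u) := fun a b =>
  (a < b) && (gen (label a) * gen (label b) != gen (label b) * gen (label a))%g.

(* [connect] is the reflexive transitive closure; [heap_lt] is the transitive
   closure because [heap_rel] is contained in the order of the positions. *)
Definition heap_le u : rel 'I_(size u) := connect (@heap_rel u).
Definition heap_lt u : rel 'I_(size u) := fun a b => (a != b) && heap_le a b.

Definition column u i : {set 'I_(size u)} := [set a | label a == i].

Definition two_in_internal_columns w : Prop :=
  forall i j, i <= j -> supp w = gen_interval i j ->
  forall u, reduced w u ->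
  forall c : 'I_n, i < c < j -> 2 <= #|column u c|.

Definition convex_subheap v u : Prop :=
  exists phi : 'I_(size v) -> 'I_(size u),
    [/\ injective phi,
        forall a, label (phi a) = label a,
        forall a b, heap_le (phi a) (phi b) = heap_le a b &
        forall a b y, heap_lt (phi a) y -> heap_lt y (phi b) ->
          exists c, y = phi c].

End Coxeter.

(** * Heap containment *)

Definition coxeter_embedding (k n : nat) (D : {set 'I_k}) (f : 'I_k -> 'I_n) : Prop :=
  [/\ {in D &, injective f},
      forall m, m = 2 \/ m = 3 -> {in D &, forall i j : 'I_k,
        ((gen i * gen j) ^+ m = 1)%g <-> ((gen (f i) * gen (f j)) ^+ m = 1)%g} &
      {in D &, forall i j : 'I_k, i < j -> f i < f j}].

Definition heap_contains_on (k n : nat) (D : {set 'I_k}) (w : 'S_n.+1) (h : 'S_k.+1) :=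
  exists (u : seq 'I_n) (v : seq 'I_k) (f : 'I_k -> 'I_n),
    [/\ reduced w u, reduced h v, coxeter_embedding D f &
        convex_subheap (map f v) u].

(* The embedding is only asked to be defined on the generators that occur in
   [h], so that containment depends on the heap of [h] alone.  If every
   generator of 'S_k.+1 occurs in [h] (lemma [heap_contains_full]) this is
   the same as embedding all of s_1,...,s_k.  If some do not, embedding all of
   them would require [w] to have unused room next to the heap of [h]: then
   s_1 in S_2 would avoid s_1 in S_3, and the enumeration fails for
   H = {s_1 in S_3}, where |S_1(H)|, |S_2(H)|, |S_3(H)| would be 1, 2, 2 for
   either set of patterns while the formula predicts 1, 2, 3. *)
Definition heap_contains (k n : nat) (w : 'S_n.+1) (h : 'S_k.+1) : Prop :=
  heap_contains_on (supp h) w h.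

Lemma heap_contains_full (k n : nat) (w : 'S_n.+1) (h : 'S_k.+1) :
  supp h = [set: 'I_k] -> heap_contains w h <-> heap_contains_on [set: 'I_k] w h.
Proof. by rewrite /heap_contains => ->. Qed.

(** * Classical patterns, given by their one-line notation *)

Definition pattern_contains (n : nat) (w : 'S_n) (p : seq nat) : bool :=
  [exists g : {ffun 'I_(size p) -> 'I_n},
    [forall a : 'I_(size p), forall b : 'I_(size p),
      ((a < b) ==> (g a < g b)) &&
      ((nth 0 p a < nth 0 p b) == (w (g a) < w (g b)))]].

(* Since the trivial group S_0 has no connected element, taking the members of
   [H] in groups 'S_k.+1 is no restriction. *)
Definition S_avoid (P : seq (seq nat)) (H : {fset {k : nat & 'S_k.+1}}) (n : nat) :
    {set 'S_n.+1} :=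
  [set w | all (fun p => ~~ pattern_contains w p) P &
           `[< forall h, h \in H -> ~ heap_contains w (tagged h) >]].

(** * Formal power series over a field *)

Record fps (R : fieldType) := Fps { coef :> nat -> R }.

HB.instance Definition _ (R : fieldType) := gen_eqMixin (fps R).
HB.instance Definition _ (R : fieldType) := gen_choiceMixin (fps R).

Section FormalPowerSeries.
Import GRing.Theory.
Local Open Scope ring_scope.
Variable R : fieldType.
Implicit Types f g h : fps R.

Lemma fpsP f g : (forall n, f n = g n) -> f = g.
Proof. by case: f g => f [g] /= E; congr Fps; apply/funext. Qed.

Definition fps_add f g := Fps (fun n => f n + g n).
Definition fps_opp f := Fps (fun n => - f n).
Definition fps_zero : fps R := Fps (fun=> 0).
Definition fps_one : fps R := Fps (fun n => (n == 0%N)%:R).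
Definition fps_X : fps R := Fps (fun n => (n == 1%N)%:R).
Definition fps_mul f g := Fps (fun n => \sum_(i < n.+1) f i * g (n - i)%N).

Let addA : associative fps_add.
Proof. by move=> f g h; apply: fpsP => n /=; rewrite addrA. Qed.
Let addC : commutative fps_add.
Proof. by move=> f g; apply: fpsP => n /=; rewrite addrC. Qed.
Let add0 : left_id fps_zero fps_add.
Proof. by move=> f; apply: fpsP => n /=; rewrite add0r. Qed.
Let addN : left_inverse fps_zero fps_opp fps_add.
Proof. by move=> f; apply: fpsP => n /=; rewrite addNr. Qed.

HB.instance Definition _ := GRing.isZmodule.Build (fps R) addA addC add0 addN.

Let trunc n f : {poly R} := \poly_(i < n.+1) f i.

Let truncE n f i : (i <= n)%N -> (trunc n f)`_i = f i.
Proof. by move=> le_in; rewrite coef_poly ltnS le_in. Qed.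

Let mul_trunc m n f g : (n <= m)%N -> (trunc m f * trunc m g)`_n = fps_mul f g n.
Proof.
move=> le_nm; rewrite coefM; apply: eq_bigr => i _.
have le_in : (i <= n)%N by rewrite -ltnS.
by rewrite !truncE // (leq_trans _ le_nm) ?leq_subr.
Qed.

Let mulA : associative fps_mul.
Proof.
move=> f g h; apply: fpsP => n.
transitivity ((trunc n f * (trunc n g * trunc n h))`_n).
  rewrite coefM; apply: eq_bigr => i _.
  have le_in : (i <= n)%N by rewrite -ltnS.
  by rewrite truncE // mul_trunc ?leq_subr.
rewrite mulrA coefM; apply: eq_bigr => i _.
have le_in : (i <= n)%N by rewrite -ltnS.
by rewrite mul_trunc // truncE ?leq_subr.
Qed.

Let mulC : commutative fps_mul.
Proof.
move=> f g; apply: fpsP => n.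
by rewrite -(@mul_trunc n) // mulrC mul_trunc.
Qed.

Let mul1 : left_id fps_one fps_mul.
Proof.
move=> f; apply: fpsP => n /=; rewrite big_ord_recl /= mul1r subn0.
by rewrite big1 ?addr0 // => i _; rewrite mul0r.
Qed.

Let mulD : left_distributive fps_mul fps_add.
Proof.
move=> f g h; apply: fpsP => n /=; rewrite -big_split /=.
by apply: eq_bigr => i _; rewrite mulrDl.
Qed.

Let one_neq0 : fps_one != 0.
Proof.
apply/eqP => /(congr1 (fun f : fps R => f 0%N)) /= /eqP.
by rewrite oner_eq0.
Qed.

HB.instance Definition _ :=
  GRing.Zmodule_isComNzRing.Build (fps R) mulA mulC mul1 mulD one_neq0.

(* The coefficients of 1/f up to degree n. *)
Fixpoint fps_inv_seq f n : seq R :=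
  if n is m.+1 then
    let s := fps_inv_seq f m in
    rcons s (- (f 0%N)^-1 * \sum_(i < m.+1) f i.+1 * s`_(m - i))
  else [:: (f 0%N)^-1].

Definition fps_unit : pred (fps R) := fun f => f 0%N != 0.
Definition fps_inv f : fps R :=
  if fps_unit f then Fps (fun n => (fps_inv_seq f n)`_n) else f.

Let size_inv_seq f n : size (fps_inv_seq f n) = n.+1.
Proof. by elim: n => //= n IHn; rewrite size_rcons IHn. Qed.

Let nth_inv_seq f m n : (n <= m)%N -> (fps_inv_seq f m)`_n = (fps_inv_seq f n)`_n.
Proof.
elim: m => [|m IHm]; first by rewrite leqn0 => /eqP->.
rewrite leq_eqVlt => /predU1P[-> //|lt_nm].
by rewrite /= nth_rcons size_inv_seq lt_nm IHm.
Qed.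

Let mulV : {in fps_unit, left_inverse 1 fps_inv *%R}.
Proof.
move=> f uf; rewrite mulrC /fps_inv ifT //; apply: fpsP => -[|n] /=.
  by rewrite big_ord1 /= mulfV.
rewrite big_ord_recl /= subn0 nth_rcons size_inv_seq ltnn eqxx mulrA mulrN mulfV //.
rewrite mulN1r addrC; apply/eqP; rewrite subr_eq0; apply/eqP/eq_bigr => i _.
by rewrite /= subSS (@nth_inv_seq f n) ?leq_subr.
Qed.

Let unitP f g : g * f = 1 -> fps_unit f.
Proof.
move=> /(congr1 (fun f : fps R => f 0%N)); rewrite /= big_ord1 /= => E.
by apply/eqP => f0; move/eqP: E; rewrite f0 mulr0 eq_sym oner_eq0.
Qed.

Let inv_out : {in [predC fps_unit], fps_inv =1 id}.
Proof.
move=> f; rewrite /fps_inv; case: ifP => // uf.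
by rewrite !inE unfold_in; rewrite /fps_unit in uf; rewrite uf.
Qed.

HB.instance Definition _ :=
  GRing.ComNzRing_hasMulInverse.Build (fps R) mulV unitP inv_out.

End FormalPowerSeries.

Definition gf_avoid (P : seq (seq nat)) (H : {fset {k : nat & 'S_k.+1}}) : fps rat :=
  Fps (fun n => (#|S_avoid P H n|%:R)%R).

(* The sum has the constant term 1 that the empty heap contributes. *)
Lemma gf_avoid0 (P : seq (seq nat)) (H : {fset {k : nat & 'S_k.+1}}) :
  (forall p, p \in P -> 1 < size p) ->
  (forall h, h \in H -> connected (tagged h)) ->
  gf_avoid P H 0 = 1%R.
Proof.
move=> P_gt1 connH; rewrite /=.
suff -> : S_avoid P H 0 = setT by rewrite cardsT card_Sn.
apply/setP=> w; rewrite !inE; apply/andP; split.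
  apply/allP => p /P_gt1; case: p => [|x [|y p]] //= _.
  apply/existsP => -[g /forallP /(_ ord0) /forallP /(_ (lift ord0 ord0))].
  by rewrite !ord1.
apply/asboolP => -[k h] /connH [i [j [_ _]]] [u [v [f _]]].
by case: (f i).
Qed.

(* Main.v *)
Require Import Defs.
From mathcomp Require Import all_boot all_order all_algebra all_fingroup.
From mathcomp Require Import finmap.
From mathcomp Require Import boolp zify ring.

(* A permutation avoids 3421, 4312 and 4321 iff the middle entry p of each of
   its 321 patterns is a pivot: exactly one larger entry l precedes it and
   exactly one smaller entry r follows it, so that p is a fixed point.  If it
   has a pivot, it is obtained in a unique way by gluing, at the first pivot p,
   a 321-avoiding permutation u of [0..p] with u p <> p and a permutation v of
   [p..n] with v p <> p: if u = a s b and v = a' s' b', where s = (p-1 p) and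
   s' = (p p+1) occur nowhere else, the glued permutation is a a' (s s' s) b b'.
   Also avoiding 4231 means that no two pivots are adjacent.

   Containing a heap amounts to having a reduced word with that heap as a
   factor.  As the glued permutation is (a s) v (s b) = (a' s') u (s' b') with
   lengths adding up, it contains the heaps of u and those of v.  Conversely, in
   any of its reduced words one of s and s' occurs exactly twice, around all the
   occurrences of the other; a factor with at least two entries in each internal
   column cannot lie across p, because between two consecutive occurrences of a
   generator in a fully commutative word both neighbours occur.

   Hence G = F + L Q for the generating function G to be found, where Q counts
   the permutations that do not fix 0, and Q = L + K Q, where K counts the
   321-avoiding permutations fixing neither end; K = L - x L = M + x, and the
   term x, for the transposition, is dropped when pivots may not be adjacent. *)

Set Implicit Arguments.
Unset Strict Implicit.
Unset Printing Implicit Defensive.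

(** * Words in the adjacent transpositions, acting on nat *)

(** Permutations are handled as functions on nat fixing every point beyond [n], so that pieces on
    [0..p], on [p..n] and on all of [0..n] can be glued, shifted and compared without casts between
    symmetric groups; [permfun] leads back to the groups.

    A word is read as a wiring diagram. In a reduced word two wires cross at most once, so the
    number of letters moving the wire [p] equals the number of inversions at [p]. For a pivot this
    number is two, which locates the two outer letters of its braid in an arbitrary reduced word,
    without any theory of braid moves.

    Reducedness of glued words and of the pieces cut from a word is not checked letter by letter: a
    word of a glued permutation can be cut, words of the pieces can be glued, and the two resulting
    bounds on the length agree. *)

Definition sw i x := if x == i then i.+1 else if x == i.+1 then i else x.

Fixpoint act (u : seq nat) x := if u is i :: u' then act u' (sw i x) else x.

(** A local condition: each letter creates an inversion over the rest of the word. [red_min] and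
    [min_red] relate it to minimal length. *)
Fixpoint red u := if u is i :: u' then (act u' i < act u' i.+1) && red u' else true.

Definition permle n (f : nat -> nat) := injective f /\ forall x, n < x -> f x = x.

Ltac swlia := rewrite /sw; repeat case: ifP; lia.

Lemma swK i : involutive (sw i).
Proof. by move=> x; swlia. Qed.

Lemma sw_inj i : injective (sw i).
Proof. exact: inv_inj (swK i). Qed.

Lemma act_cat u v x : act (u ++ v) x = act v (act u x).
Proof. by elim: u x => //= i u IHu x; rewrite IHu. Qed.

Lemma act_inj u : injective (act u).
Proof. by elim: u => [|i u IHu] x y //= /IHu /sw_inj. Qed.

Lemma act_permle n u : all (fun i => i < n) u -> permle n (act u).
Proof.
move=> ltu; split; first exact: act_inj.
elim: u ltu => //= i u IHu /andP[lt_in ltu] x lt_nx.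
by rewrite -[RHS](IHu ltu) //; congr act; swlia.
Qed.

Lemma permle_lt n f x : permle n f -> (f x <= n) = (x <= n).
Proof.
move=> [finj ffix]; have [lt_nx|le_xn] := ltnP n x; first by rewrite ffix //; lia.
have [lt_nfx|] := ltnP n (f x); last by lia.
have/finj := ffix _ lt_nfx; lia.
Qed.

Lemma permle_sw n f i : i < n -> permle n f -> permle n (f \o sw i).
Proof.
move=> lt_in [finj ffix]; split; first by apply: inj_comp => //; exact: sw_inj.
by move=> x lt_nx /=; rewrite -[RHS]ffix //; congr f; swlia.
Qed.

Lemma permle_surj n f y : permle n f -> exists x, f x = y.
Proof.
move=> [finj ffix]; have [lt_ny|le_yn] := ltnP n y; first by exists y; apply: ffix.
pose g (x : 'I_n.+1) : 'I_n.+1 := inord (f x).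
have gE x : g x = f x :> nat.
  by rewrite inordK // ltnS (permle_lt x (conj finj ffix)) -ltnS.
have ginj : injective g.
  by move=> a b E; apply/val_inj/finj; rewrite -!gE E.
have [h gK hK] := injF_bij ginj.
by exists (h (inord y)); rewrite -gE hK inordK.
Qed.

(** * Inversions and the length of a word *)

Definition inv (f : nat -> nat) x y := (x < y) && (f y < f x).

Definition deg n f x := \sum_(y < n) (inv f x y + inv f y x).

Lemma big_sw n i (g : nat -> nat) : i.+1 < n ->
  \sum_(y < n) g (sw i y) = \sum_(y < n) g y.
Proof.
move=> lt_in.
have h_lt (y : 'I_n) : sw i y < n by move: (ltn_ord y); swlia.
by rewrite [RHS](reindex_inj (h := fun y => Ordinal (h_lt y))) // => a b [] /sw_inj /val_inj.
Qed.

Lemma sum_pred1 n i : i < n -> \sum_(y < n) (y == i :> nat) = 1.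
Proof.
move=> lt_in; rewrite (bigD1 (Ordinal lt_in)) //= eqxx big1 // => y.
by rewrite -val_eqE /= => /negPf->.
Qed.

(** Precomposing with an ascent renames the positions [i] and [i.+1], keeps the old inversions and
    creates one new inversion, between these two positions; it is seen once from either end. *)
Lemma deg_sw n f i x : i.+1 < n -> f i < f i.+1 ->
  deg n (f \o sw i) x = deg n f (sw i x) + ((x == i) + (x == i.+1)).
Proof.
move=> lt_in asc; rewrite /deg -(big_sw (fun y => inv (f \o sw i) x y + inv (f \o sw i) y x) lt_in).
transitivity (\sum_(y < n) (inv f (sw i x) y + inv f y (sw i x) +
    ((x == i) * (y == i :> nat) + (x == i.+1) * (y == i.+1 :> nat)))).
  apply: eq_bigr => y _; rewrite /inv /= !swK.
  have [->|nxi] := eqVneq x i.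
    rewrite /sw eqxx (_ : i == i.+1 = false); last by lia.
    have [->|nyi] := eqVneq (y : nat) i; first by lia.
    have [->|nyi1] := eqVneq (y : nat) i.+1; by lia.
  have [->|nxi1] := eqVneq x i.+1.
    rewrite /sw eqxx (_ : i.+1 == i = false); last by lia.
    have [->|nyi] := eqVneq (y : nat) i; first by lia.
    have [->|nyi1] := eqVneq (y : nat) i.+1; by lia.
  rewrite !mul0n !addn0 (_ : sw i x = x); last by swlia.
  have -> : (x < sw i y) = (x < y) by swlia.
  have -> : (sw i y < x) = (y < x) by swlia.
  by [].
rewrite big_split /=; congr addn; rewrite big_split /= -!big_distrr /= !sum_pred1 //; lia.
Qed.

(** Each inversion is counted at both of its ends, so this is twice the number of inversions; hence
    the doubled size in [tdeg_act]. *)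
Definition tdeg n f := \sum_(x < n) deg n f x.

Lemma tdeg_sw n f i : i.+1 < n -> f i < f i.+1 -> tdeg n (f \o sw i) = tdeg n f + 2.
Proof.
move=> lt_in asc; rewrite /tdeg.
under eq_bigr do rewrite deg_sw //.
by rewrite big_split (big_sw (deg n f)) //= big_split /= !sum_pred1 //; lia.
Qed.

Lemma eq_deg n f g x : f =1 g -> deg n f x = deg n g x.
Proof. by move=> E; apply: eq_bigr => y _; rewrite /inv !E. Qed.

Lemma eq_tdeg n f g : f =1 g -> tdeg n f = tdeg n g.
Proof. by move=> E; apply: eq_bigr => y _; apply: eq_deg. Qed.

Lemma tdeg_act n u : all (fun i => i.+1 < n) u ->
  tdeg n (act u) <= (size u).*2 ?= iff red u.
Proof.
elim: u => [|i u IHu] /=.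
  rewrite /tdeg big1 // => x _; rewrite /deg big1 // => y _; rewrite /inv; lia.
case/andP => lt_in /IHu[le_u eq_u]; have neq := @act_inj u i i.+1.
case: (ltngtP (act u i) (act u i.+1)) => [lt_i|gt_i|/neq]; last lia.
  have -> : tdeg n (fun x => act u (sw i x)) = tdeg n (act u) + 2 by apply: tdeg_sw.
  split; first by lia.
  by rewrite /= -eq_u; lia.
(* At a descent of [act u] the new letter destroys an inversion, so the bound becomes strict. *)
suff E : tdeg n (act u) = tdeg n (act (i :: u)) + 2.
  by split=> /=; move: E le_u => /=; lia.
rewrite -(@tdeg_sw n _ i) //; first by apply: eq_tdeg => x /=; rewrite swK.
by rewrite /= /sw !eqxx (_ : i.+1 == i = false) //; lia.
Qed.

Lemma words_bounded (u : seq nat) : exists n, all (fun i => i.+1 < n) u.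
Proof.
elim: u => [|i u [n IHn]]; first by exists 0.
exists (maxn n i.+2) => /=; apply/andP; split; first by lia.
by apply: sub_all IHn => j; lia.
Qed.

Lemma red_min u v : red u -> act v =1 act u -> size u <= size v.
Proof.
move=> redu E; have [n] := words_bounded (u ++ v).
rewrite all_cat => /andP[/tdeg_act[_ eu] /tdeg_act[lev _]].
by move: eu; rewrite redu -(eq_tdeg n E) => /eqP; lia.
Qed.

Lemma min_red u v : red u -> act v =1 act u -> size v <= size u -> red v.
Proof.
move=> redu E le_vu; have [n] := words_bounded (u ++ v).
rewrite all_cat => /andP[/tdeg_act[_ eu] /tdeg_act[lev <-]].
by move: eu; rewrite redu -(eq_tdeg n E) => /eqP; lia.
Qed.

Lemma permle_descent n f : permle n f -> (forall i, i < n -> f i < f i.+1) -> f =1 id.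
Proof.
move=> pf asc.
have ge x : x <= n -> x <= f x.
  by elim: x => // x IHx lt_xn; apply: leq_ltn_trans (asc _ lt_xn); apply: IHx; lia.
have le k : k <= n -> f (n - k) <= n - k.
  elim: k => [|k IHk] lt_kn; first by rewrite subn0 (permle_lt _ pf).
  have := asc (n - k.+1); have -> : (n - k.+1).+1 = n - k by lia.
  move=> /(_ _) lt; have := IHk (ltnW lt_kn); have := lt ltac:(lia); lia.
move=> x; have [lt_nx|le_xn] := ltnP n x; first exact: pf.2.
have := ge x le_xn; have := le (n - x); rewrite subKn //; lia.
Qed.

(** Bubble sort: as long as there is a descent, undoing it lowers the number of inversions. *)
Lemma red_exists n f : permle n f -> exists u, [/\ red u, act u =1 f & all (fun i => i < n) u].
Proof.
have [m] := ubnP (tdeg n.+1 f); elim: m f => // m IHm f lt_m pf.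
case: (EM (exists2 i, i < n & f i.+1 < f i)) => [[i lt_in desc]|noD]; last first.
  exists [::]; split=> // x; rewrite (permle_descent pf) // => i lt_in.
  have [//|le_fi] := ltnP (f i) (f i.+1); case: noD; exists i => //.
  have := @pf.1 i i.+1; lia.
have sw_i : sw i i = i.+1 by rewrite /sw eqxx.
have sw_i1 : sw i i.+1 = i by swlia.
have tf : tdeg n.+1 f = tdeg n.+1 (f \o sw i) + 2.
  rewrite -(@tdeg_sw n.+1 _ i) //=; last by rewrite sw_i sw_i1.
  by apply: eq_tdeg => x /=; rewrite swK.
have [||u [redu fu ltu]] := IHm (f \o sw i); [by lia|exact: permle_sw|].
exists (i :: u); split => /=; last by rewrite lt_in.
  by rewrite redu !fu /= sw_i sw_i1 desc.
by move=> x; rewrite fu /= swK.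
Qed.

Lemma red_lt n u : red u -> permle n (act u) -> all (fun i => i < n) u.
Proof.
elim: u => //= i u IHu /andP[asc redu] pu.
(* Otherwise [i.+1] is fixed by the whole word, so the larger value [act u i.+1] exceeds [n] and is
   fixed as well; injectivity then forces it to be [i]. *)
have lt_in : i < n.
  have := pu.2 i.+1; have := pu.2 (act u i.+1).
  have := @act_inj u (sw i (act u i.+1)) i.+1.
  rewrite /= (_ : sw i i.+1 = i); last by swlia.
  have : sw i (act u i.+1) = i.+1 -> act u i.+1 = i by swlia.
  by rewrite ltnNge; lia.
rewrite lt_in IHu //; have := permle_sw lt_in pu => /=.
by case=> inj_u fix_u; split; [exact: act_inj|move=> x /fix_u /=; rewrite swK].
Qed.

Lemma red_ge m u : red u -> (forall x, x < m -> act u x = x) -> all (leq m) u.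
Proof.
elim: u => //= i u IHu /andP[asc redu] fixu.
have sw_i : sw i i = i.+1 by rewrite /sw eqxx.
have le_mi : m <= i.
  have := fixu i; have := fixu (act u i); have := @act_inj u (sw i (act u i)) i.
  have : sw i (act u i) = i -> act u i = i.+1 by swlia.
  by rewrite sw_i leqNgt; lia.
rewrite le_mi IHu // => x lt_xm; rewrite -[RHS]fixu //; congr act; swlia.
Qed.

Fixpoint touch u x := if u is i :: u' then (x == i) + (x == i.+1) + touch u' (sw i x) else 0.

(** In a reduced word a wire crosses exactly the wires with which its starting point forms an
    inversion, each of them once. *)
Lemma touch_deg n u x : red u -> all (fun i => i.+1 < n) u -> touch u x = deg n (act u) x.
Proof.
elim: u x => [|i u IHu] x /=.
  move=> _ _; rewrite /deg big1 // => y _; rewrite /inv; lia.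
case/andP => asc redu /andP[lt_in ltu].
have -> : deg n (fun x => act u (sw i x)) x = deg n (act u) (sw i x) + ((x == i) + (x == i.+1)).
  exact: deg_sw.
by rewrite IHu //; lia.
Qed.

(** * Pivots and gluing *)

Definition pivot_with f p l r :=
  [/\ inv f l p, inv f p r, forall x, inv f x p -> x = l & forall x, inv f p x -> x = r].

Definition pivot f p := exists l r, pivot_with f p l r.

Lemma permleW n m f : n <= m -> permle n f -> permle m f.
Proof. by move=> le_nm [finj ffix]; split=> // x lt_mx; apply: ffix; lia. Qed.

Lemma sum_ltn n m : m <= n -> \sum_(y < n) (y < m) = m.
Proof.
suff -> : \sum_(y < n) (y < m) = minn n m by lia.
by elim: n => [|n IHn]; rewrite ?big_ord0 ?big_ord_recr /= ?IHn; lia.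
Qed.

(** The positions of the values below [f p] are those before [p], with [l] removed and [r] added;
    there are [f p] of the former and [p] of the latter. *)
Lemma pivot_fix n f p : permle n f -> pivot f p -> f p = p.
Proof.
move=> pf [l [r [inv_l inv_r uniq_l uniq_r]]].
(* The range is enlarged so that it contains [l], [p] and [r]. *)
have {pf}pf : permle (n + r) f by apply: permleW pf; lia.
have g_lt (x : 'I_(n + r).+1) : f x < (n + r).+1.
  by rewrite ltnS (permle_lt _ pf) -ltnS.
have count : \sum_(x < (n + r).+1) (f x < f p) = f p.
  rewrite -[RHS](@sum_ltn (n + r).+1); last by rewrite leqW // (permle_lt _ pf); move: inv_r; rewrite /inv; lia.
  rewrite [RHS](reindex_inj (h := fun x => Ordinal (g_lt x))) // => a b [] /pf.1 /val_inj //.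
have : \sum_(x < (n + r).+1) ((f x < f p) + (x == l :> nat)) =
       \sum_(x < (n + r).+1) ((x < p) + (x == r :> nat)).
  apply: eq_bigr => x _; have := uniq_l x; have := uniq_r x; have := pf.1 x p.
  move: inv_l inv_r; rewrite /inv => /andP[l1 l2] /andP[r1 r2].
  have [->|n1] := eqVneq (x : nat) l; first by lia.
  have [->|n2] := eqVneq (x : nat) r; first by lia.
  by have [->|n3] := eqVneq (x : nat) p; lia.
rewrite !big_split /= count sum_ltn ?sum_pred1 //; move: inv_l inv_r; rewrite /inv; lia.
Qed.

Lemma pivot_deg n f p l r : r < n -> pivot_with f p l r -> deg n f p = 2.
Proof.
move=> lt_rn [inv_l inv_r uniq_l uniq_r].
transitivity (\sum_(y < n) ((y == r :> nat) + (y == l :> nat))).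
  apply: eq_bigr => y _; have := uniq_l y; have := uniq_r y.
  move: inv_l inv_r; rewrite /inv => inv_l inv_r.
  have [->|n1] := eqVneq (y : nat) r; first by lia.
  by have [->|n2] := eqVneq (y : nat) l; lia.
by rewrite big_split /= !sum_pred1 //; move: inv_l inv_r; rewrite /inv; lia.
Qed.

Definition free x (u : seq nat) := all (fun i => (i != x) && (i.+1 != x)) u.

Lemma free_act x u : free x u -> act u x = x.
Proof.
elim: u => //= i u IHu /andP[nx fu]; rewrite -[RHS]IHu //; congr act; swlia.
Qed.

Lemma touch0 u x : touch u x = 0 -> free x u.
Proof.
elim: u => //= i u IHu E; have sx : sw i x = x by swlia.
by move: E; rewrite sx => E; rewrite IHu; lia.
Qed.

Lemma touchS u x k : touch u x = k.+1 -> exists a i b,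
  [/\ u = a ++ i :: b, free x a, (i == x) || (i.+1 == x) & touch b (sw i x) = k].
Proof.
elim: u => //= i u IHu; have [ix E|nix] := boolP ((i == x) || (i.+1 == x)).
  by exists [::], i, u; split=> //; lia.
have sx : sw i x = x by swlia.
rewrite sx => E; have [] := IHu; first by lia.
move=> a [j [b [-> fa jx Eb]]]; exists (i :: a), j, b; split=> //=.
by rewrite fa; lia.
Qed.

(* The wire [p] is crossed exactly twice, once in each direction, both times
   at the same place, next to [p]. *)
Lemma pivot_word W p : red W -> pivot (act W) p -> exists i a b c,
  [/\ W = a ++ i :: b ++ i :: c, (i == p) || (i.+1 == p), free p a, free p c &
      free (sw i p) b].
Proof.
move=> redW pivW; have [l [r pv]] := pivW.
have [n ltW] := words_bounded W.
have : touch W p = 2.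
  rewrite (@touch_deg (n + r.+1)) ?(pivot_deg _ pv) //; first by lia.
  by apply: sub_all ltW => i; lia.
move=> /touchS[a [i [b [eW fa ip]]]] /touchS[b' [j [c [eb fb js tc]]]].
have Wp : act W p = p.
  by apply: (@pivot_fix n) => //; apply: act_permle; apply: sub_all ltW => k; lia.
have fc := touch0 tc.
move: Wp; rewrite eW eb act_cat /= act_cat /= (free_act fa) (free_act fb) (free_act fc) => E.
have eij : i = j by move: E; swlia.
rewrite -eij in E *; exists i, a, b', c; split=> //.
by move: fc; rewrite -eij E.
Qed.

(** * Cutting a word at p, and gluing *)

Definition low p (u : seq nat) := [seq i <- u | i < p].
Definition high p (u : seq nat) := [seq i - p | i <- u & p <= i].

(** Without the letter [p.-1], the wires from [p] on never mix with those below. The wire [p]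
    belongs to the upper block here, and to the lower one in [act_split_above], where the letter [p]
    is missing. *)
Lemma act_split_below p u : all (fun i => i.+1 != p) u ->
  [/\ forall x, x < p -> act u x = act (low p u) x /\ act u x < p,
      forall x, p <= x -> act u x = p + act (high p u) (x - p) & act (low p u) p = p].
Proof.
rewrite /low /high; elim: u => [|i u IHu] /=; first by split=> // x; lia.
case/andP=> nip /IHu[IH1 IH2 IH3].
case: (ltnP i p) => [lt_ip|le_pi] /=.
  split=> [x lt_xp|x le_px|].
  - by apply: IH1; swlia.
  - by rewrite (_ : sw i x = x) ?IH2 //; swlia.
  - by rewrite (_ : sw i p = p) //; swlia.
split=> [x lt_xp|x le_px|//].
- by rewrite (_ : sw i x = x); [exact: IH1|swlia].
- by rewrite IH2 /=; [congr (_ + act _ _); swlia|swlia].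
Qed.

Lemma act_split_above p u : all (fun i => i != p) u ->
  [/\ forall x, x <= p -> act u x = act (low p u) x /\ act u x <= p,
      forall x, p < x -> act u x = p + act (high p u) (x - p) /\ p < act u x &
      act (high p u) 0 = 0].
Proof.
rewrite /low /high; elim: u => [|i u IHu] /=; first by split=> // x; lia.
case/andP=> nip /IHu[IH1 IH2 IH3].
case: (ltnP i p) => [lt_ip|le_pi] /=.
  split=> [x lt_xp|x le_px|//].
  - by apply: IH1; swlia.
  - by rewrite (_ : sw i x = x); [exact: IH2|swlia].
split=> [x lt_xp|x le_px|].
- by rewrite (_ : sw i x = x); [exact: IH1|swlia].
- have [|E lt] := IH2 (sw i x); first by swlia.
  by split=> //; rewrite E; congr (_ + act _ _); swlia.
- by rewrite (_ : sw (i - p) 0 = 0) //; swlia.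
Qed.

(** In terms of strands: the strand of [u] arriving at [p] continues as the strand of [v] starting
    at 0, and the strand of [v] arriving at 0 continues as the strand of [u] starting at [p]. The
    point [p] itself is left to the middle strand of the braid. *)
Definition glue p (u v : nat -> nat) x :=
  if x < p then if u x == p then p + v 0 else u x
  else if x == p then p
  else if v (x - p) == 0 then u p else p + v (x - p).

Lemma low_cat p a b : low p (a ++ b) = low p a ++ low p b.
Proof. exact: filter_cat. Qed.

Lemma high_cat p a b : high p (a ++ b) = high p a ++ high p b.
Proof. by rewrite /high filter_cat map_cat. Qed.

Lemma free_below p u : free p u -> all (fun i => i.+1 != p) u.
Proof. by apply: sub_all => i /andP[]. Qed.

Lemma free_above p u : free p u -> all (fun i => i != p) u.
Proof. by apply: sub_all => i /andP[]. Qed.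

(** During [b] the wire [p] runs at [s], which leaves place [p] to the strands changing sides. The
    proof follows every starting point through the five factors; [v 0 <> 0] ensures that the strand
    entering [b] at [p] does not leave it there. *)
Lemma glue_word_below s p a b c : s.+1 = p -> free p a -> free s b -> free p c ->
  let v := act (high p (a ++ b ++ c)) in v 0 <> 0 ->
  act (a ++ s :: b ++ s :: c) =1 glue p (act (low p (a ++ s :: b ++ c))) v.
Proof.
move=> sp fa fb fc v v0.
have sps : sw s s = p by rewrite /sw eqxx.
have sp_s : sw s p = s by swlia.
have swx x : x <> s -> x <> p -> sw s x = x by swlia.
have nb : all (fun i => i.+1 != p) b by apply: sub_all fb => i; lia.
have [a1 a2 a3] := act_split_below (free_below fa).
have [b1 b2 b3] := act_split_below nb.
have [c1 c2 c3] := act_split_below (free_below fc).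
have pa := free_act fa; have pb := free_act fb; have pc := free_act fc.
have a0 : act (high p a) 0 = 0 by have := a2 p; rewrite subnn pa; lia.
have c0 : act (high p c) 0 = 0 by have := c2 p; rewrite subnn pc; lia.
have eu x : act (low p (a ++ s :: b ++ c)) x =
    act (low p c) (act (low p b) (sw s (act (low p a) x))).
  by rewrite !(low_cat, act_cat) /= -sp ltnSn /= !(low_cat, act_cat).
have ev x : v x = act (high p c) (act (high p b) (act (high p a) x)).
  by rewrite /v !(high_cat, act_cat).
have ew x : act (a ++ s :: b ++ s :: c) x = act c (sw s (act b (sw s (act a x)))).
  by rewrite act_cat /= act_cat.
have v0E : v 0 = act (high p c) (act (high p b) 0) by rewrite ev a0.
have bp : act b p <> p.
  by move=> E; apply: v0; rewrite v0E; have := b2 p; rewrite subnn => H; rewrite (_ : act _ 0 = 0) //; lia.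
move=> x; rewrite ew /glue.
have [lt_xp|le_px] := ltnP x p.
  have [ax lt_ax] := a1 x lt_xp; rewrite eu -ax.
  (* The strand that goes up does so at the first [s]. *)
  have [axs|axs] := eqVneq (act a x) s.
    rewrite axs sps b3 c3 eqxx; have := b2 p; rewrite subnn => bpE.
    have bps : act b p <> s by have := @act_inj b p s; rewrite pb; lia.
    by rewrite (swx _ bps bp) c2 bpE // ?leq_addr // addKn v0E.
  have sax : sw s (act a x) = act a x by apply: swx; lia.
  have [bx lt_bx] := b1 _ lt_ax.
  have sbx : sw s (act b (act a x)) = act b (act a x).
    by apply: swx; have := @act_inj b (act a x) s; rewrite ?pb; lia.
  rewrite sax sbx -bx; have [cx lt_cx] := c1 _ lt_bx.
  by rewrite -cx ifN //; lia.
have [->|nxp] := eqVneq x p; first by rewrite pa sp_s pb sps pc.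
have le_ax : p <= act a x by rewrite a2 ?leq_addr.
have ax_p : act a x <> p by have := @act_inj a x p; rewrite pa; lia.
have ha : act a x - p = act (high p a) (x - p) by rewrite a2 // addKn.
have sax : sw s (act a x) = act a x by apply: swx; lia.
rewrite sax (b2 _ le_ax) ev -ha.
(* The strand that comes down does so at the second [s]. *)
set y := act (high p b) _; have [->|y0] := eqVneq y 0.
  have ltsp : s < p by lia.
  by rewrite c0 addn0 sp_s eu eqxx a3 sp_s -(b1 s ltsp).1 pb -(c1 s ltsp).1.
rewrite swx; [|lia|lia]; rewrite c2 ?leq_addr // addKn ifN //.
by apply/eqP; have := @act_inj (high p c) y 0; rewrite c0; lia.
Qed.

(** The mirror image: the wire [p] now runs at [p.+1] during [b]. *)
Lemma glue_word_above p a b c : free p a -> free p.+1 b -> free p c ->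
  let u := act (low p (a ++ b ++ c)) in u p <> p ->
  act (a ++ p :: b ++ p :: c) =1 glue p u (act (high p (a ++ p :: b ++ c))).
Proof.
move=> fa fb fc u up.
have spp : sw p p = p.+1 by rewrite /sw eqxx.
have spp1 : sw p p.+1 = p by swlia.
have swx x : x <> p -> x <> p.+1 -> sw p x = x by swlia.
have nb : all (fun i => i != p) b by apply: sub_all fb => i; lia.
have [a1 a2 a3] := act_split_above (free_above fa).
have [b1 b2 b3] := act_split_above nb.
have [c1 c2 c3] := act_split_above (free_above fc).
have pa := free_act fa; have pb := free_act fb; have pc := free_act fc.
have ev x : act (high p (a ++ p :: b ++ c)) x =
    act (high p c) (act (high p b) (sw 0 (act (high p a) x))).
  by rewrite !(high_cat, act_cat) /high /= leqnn /= subnn !(filter_cat, map_cat, act_cat).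
have eu x : u x = act (low p c) (act (low p b) (act (low p a) x)).
  by rewrite /u !(low_cat, act_cat).
have ew x : act (a ++ p :: b ++ p :: c) x = act c (sw p (act b (sw p (act a x)))).
  by rewrite act_cat /= act_cat.
have a_p : act (low p a) p = p by rewrite -(a1 p (leqnn p)).1.
have bp : act b p <> p.
  by move=> E; apply: up; rewrite eu a_p -(b1 p (leqnn p)).1 E -(c1 p (leqnn p)).1.
have le_bp : act b p < p by have := (b1 p (leqnn p)).2; lia.
have hb1 : act (high p b) 1 = 1 by have := (b2 p.+1 (ltnSn p)).1; rewrite pb subSnn; lia.
move=> x; rewrite ew /glue.
have [lt_xp|le_px] := ltnP x p.
  have [ax le_ax] := a1 x (ltnW lt_xp); rewrite eu -ax.
  have ax_p : act a x <> p by have := @act_inj a x p; rewrite pa; lia.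
  have sax : sw p (act a x) = act a x by apply: swx; lia.
  have [bx le_bx] := b1 _ le_ax; rewrite sax -bx.
  have [bxp|bxp] := eqVneq (act b (act a x)) p.
    rewrite bxp spp -(c1 p (leqnn p)).1 pc eqxx (c2 _ (ltnSn p)).1 subSnn.
    by rewrite ev a3 /sw /= hb1.
  have sbx : sw p (act b (act a x)) = act b (act a x) by apply: swx; lia.
  rewrite sbx -(c1 _ le_bx).1 ifN //; apply/eqP.
  by have := @act_inj c (act b (act a x)) p; rewrite pc; lia.
have [->|nxp] := eqVneq x p; first by rewrite pa spp pb spp1 pc.
have lt_px : p < x by lia.
have [ax lt_ax] := a2 x lt_px.
have ha : act a x - p = act (high p a) (x - p) by rewrite ax addKn.
rewrite ev -ha.
have [axp|axp] := eqVneq (act a x) p.+1.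
  rewrite axp spp1 subSnn (_ : sw 0 1 = 0) // b3 c3 eqxx eu a_p -(b1 p (leqnn p)).1.
  rewrite swx; [|lia|lia].
  by rewrite (c1 _ (ltnW le_bp)).1.
have sax : sw p (act a x) = act a x by apply: swx; lia.
have sax' : sw 0 (act a x - p) = act a x - p by swlia.
rewrite sax sax' ; have [bx lt_bx] := b2 _ lt_ax.
have bx_p : act b (act a x) <> p.+1 by have := @act_inj b (act a x) p.+1; rewrite pb; lia.
have hb : act b (act a x) - p = act (high p b) (act a x - p) by rewrite bx addKn.
rewrite -hb swx; [|lia|lia].
have [cx lt_cx] := c2 _ lt_bx; rewrite ifN -?cx //.
by apply/eqP; lia.
Qed.

(** * Reduced words of a glued permutation *)

Definition glueable p m u v := [/\ permle p u, u p <> p, permle m v & v 0 <> 0].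

(** A coset decomposition: the letters [r], ..., [s] carry the maximum [p] from its position [r] to
    the end, and what remains fixes [p], so it uses letters below [s] only. *)
Lemma word_last p u : permle p u -> u p <> p -> exists s a b,
  [/\ s.+1 = p, red (a ++ s :: b), act (a ++ s :: b) =1 u & all (fun i => i < s) (a ++ b)].
Proof.
case: p => [|s] pu up; first by have := permle_lt 0 pu; lia.
have [r ur] := permle_surj s.+1 pu.
have lt_rs : r < s.+1.
  have := permle_lt r pu; rewrite ur leqnn => /esym.
  by rewrite leq_eqVlt => /predU1P[E|//]; case: up; rewrite -{1}E.
exists s; move: {up} pu ur lt_rs; have [k] := ubnP (s - r).
elim: k r u => // k IHk r u lt_k pu ur lt_rs.
have asc : u r.+1 < u r.
  rewrite ur; have := permle_lt r.+1 pu; have := pu.1 r.+1 r; rewrite ur; lia.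
have pur : permle s.+1 (u \o sw r) by apply: permle_sw.
have E1 : sw r r = r.+1 by swlia.
have E2 : sw r r.+1 = r by swlia.
have cons_ok w : red w -> act w =1 u \o sw r -> red (r :: w) /\ act (r :: w) =1 u.
  by move=> rw ew; split=> [|x] /=; rewrite !ew /= ?swK // E1 E2 asc.
have [ers|nrs] := eqVneq r s.
  have [w [rw ew lw]] := red_exists pur.
  have [rrw erw] := cons_ok w rw ew.
  have {lw}lw : all (fun i => i < s) w.
    apply: red_lt => //; split=> [|x lt_sx]; first exact: act_inj.
    rewrite ew /=; have [->|nx] := eqVneq x s.+1; first by rewrite -{1}ers E2 ur.
    by rewrite (_ : sw r x = x); [apply: pu.2; lia|swlia].
  by exists [::], w; rewrite /= -{2}ers in lw *; split=> //; rewrite -?ers.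
have [||||a [b [_ ra ea la]]] := IHk r.+1 (u \o sw r) => //; first by lia.
- by rewrite /= E2.
- lia.
have [rra era] := cons_ok _ ra ea.
by exists (r :: a), b; split=> //=; rewrite la; lia.
Qed.

(** Dually, 0 is carried from its position to the front, the last letter used being 0, and what
    remains fixes 0. *)
Lemma word_first m v : permle m v -> v 0 <> 0 -> exists a b,
  [/\ red (a ++ 0 :: b), act (a ++ 0 :: b) =1 v & all (fun i => 0 < i) (a ++ b)].
Proof.
move=> pv v0; have [r vr] := permle_surj 0 pv.
have {v0}r0 : r <> 0 by move=> E; apply: v0; rewrite -{1}E.
elim: r v pv vr r0 => [|r IHr] v pv vr r0; first by case: r0.
have lt_rm : r < m by have := permle_lt r.+1 pv; rewrite vr.
have asc : v r.+1 < v r by have := pv.1 r.+1 r; rewrite vr; lia.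
have pvr : permle m (v \o sw r) by apply: permle_sw.
have E1 : sw r r = r.+1 by swlia.
have E2 : sw r r.+1 = r by swlia.
have cons_ok w : red w -> act w =1 v \o sw r -> red (r :: w) /\ act (r :: w) =1 v.
  by move=> rw ew; split=> [|x] /=; rewrite !ew /= ?swK // E1 E2 asc.
have [er0|nr0] := eqVneq r 0.
  have [w [rw ew lw]] := red_exists pvr.
  have [rrw erw] := cons_ok w rw ew.
  exists [::], w; rewrite /= -er0; split=> //; apply: red_ge => // x.
  by rewrite er0 ltnS leqn0 => /eqP->; rewrite ew /= -er0 E1 vr.
have [||a [b [ra ea la]]] := IHr (v \o sw r) pvr; [by rewrite /= E1|exact/eqP|].
have [rra era] := cons_ok _ ra ea.
by exists (r :: a), b; split=> //=; rewrite la; lia.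
Qed.

Definition shift d (u : seq nat) := [seq d + i | i <- u].

Lemma low_shift p d u : p <= d -> low p (shift d u) = [::].
Proof. by move=> le_pd; elim: u => //= i u ->; rewrite ltnNge (_ : p <= d + i) //; lia. Qed.

Lemma high_shift p u : high p (shift p u) = u.
Proof.
elim: u => //= i u IHu; rewrite /high /= leq_addr /=; congr cons => //.
by rewrite addKn.
Qed.

Lemma all_ltW m n (u : seq nat) : all (fun i => i < m) u -> m <= n -> all (fun i => i < n) u.
Proof. by move=> ltu le_mn; apply: sub_all ltu => i; lia. Qed.

Lemma low_id p u : all (fun i => i < p) u -> low p u = u.
Proof. exact: all_filterP. Qed.

Lemma high_nil p u : all (fun i => i < p) u -> high p u = [::].
Proof.
by rewrite /high => ltu; rewrite (eq_in_filter (a2 := pred0)) ?filter_pred0 // => i /(allP ltu) /=; lia.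
Qed.

Lemma glue_word_left p m u V : glueable p m u (act V) -> exists s a b,
  [/\ s.+1 = p, red (a ++ s :: b), act (a ++ s :: b) =1 u &
      act ((a ++ [:: s]) ++ shift p V ++ s :: b) =1 glue p u (act V)].
Proof.
move=> [pu up pv v0]; have [s [a [b [sp ra ea]]]] := word_last pu up.
rewrite all_cat => /andP[la lb]; exists s, a, b; split=> //.
have eh : high p (a ++ shift p V ++ b) = V.
  by rewrite !high_cat high_shift !high_nil ?cats0 // ; apply: all_ltW; eauto; lia.
have el : low p (a ++ s :: shift p V ++ b) = a ++ s :: b.
  rewrite low_cat /= low_cat low_shift // -{2}sp ltnSn !low_id //; apply: all_ltW; eauto; lia.
move=> x; rewrite -catA /= (@glue_word_below s p) ?eh //; first last.
- by apply: sub_all lb => i; lia.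
- by rewrite /free all_map; apply/allP => i _ /=; lia.
- by apply: sub_all la => i; lia.
by rewrite el /glue !ea.
Qed.

Lemma glue_word_right p m U v : glueable p m (act U) v -> all (fun i => i < p) U ->
  exists a b, [/\ red (a ++ 0 :: b), act (a ++ 0 :: b) =1 v &
      act ((shift p a ++ [:: p]) ++ U ++ p :: shift p b) =1 glue p (act U) v].
Proof.
move=> [pu up pv v0] ltU; have [a [b [ra ea]]] := word_first pv v0.
rewrite all_cat => /andP[la lb]; exists a, b; split=> //.
have el : low p (shift p a ++ U ++ shift p b) = U.
  by rewrite !low_cat !low_shift // cats0 low_id.
have eh : high p (shift p a ++ p :: U ++ shift p b) = a ++ 0 :: b.
  have hp : high p [:: p] = [:: 0] by rewrite /high /= leqnn /= subnn.
  by rewrite high_cat (high_cat p [:: p]) high_cat !high_shift hp high_nil.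
have fr c : all [eta ltn 0] c -> free p (shift p c).
  by move=> lc; rewrite /free all_map; apply: sub_all lc => i /=; lia.
move=> x; rewrite -catA /= (@glue_word_above p) ?el //; first last.
- exact: fr.
- by apply: sub_all ltU => i; lia.
- exact: fr.
by rewrite eh /glue !ea.
Qed.

Lemma eq_glue p u u' v v' : u =1 u' -> v =1 v' -> glue p u v =1 glue p u' v'.
Proof. by move=> eu ev x; rewrite /glue !eu !ev. Qed.

(** Away from the two strands changing sides, the gluing shows [u] below [p] and [v] above it. The
    missing values [v 0] and [u p] are read at the positions where [u] takes the value [p] and [v]
    the value 0. *)
Lemma glue_inj p m u v u' v' : glueable p m u v -> glueable p m u' v' ->
  glue p u v =1 glue p u' v' -> u =1 u' /\ v =1 v'.
Proof.
move=> [pu up pv v0] [pu' up' pv' v0'] E.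
have lt x : x < p -> u x = u' x.
  move=> lt_xp; have := E x; rewrite /glue lt_xp.
  have := permle_lt x pu; have := permle_lt x pu'; case: eqP; case: eqP; lia.
have gt x : 0 < x -> v x = v' x.
  move=> gt_x; have := E (p + x); rewrite /glue ltnNge leq_addr addKn /=.
  rewrite (_ : p + x == p = false); last by lia.
  have := permle_lt p pu; have := permle_lt p pu'; case: eqP; case: eqP; lia.
have [l ul] := permle_surj p pu.
have lt_lp : l < p.
  have := permle_lt l pu; rewrite ul leqnn => /esym; rewrite leq_eqVlt => /predU1P[El|//].
  by case: up; rewrite -{1}El.
have [r vr] := permle_surj 0 pv.
have gt_r : 0 < r by rewrite lt0n; apply/eqP => Er; apply: v0; rewrite -{1}Er.
have ev0 : v 0 = v' 0.
  by have := E l; rewrite /glue lt_lp -lt // ul eqxx; lia.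
have eup : u p = u' p.
  have := E (p + r); rewrite /glue ltnNge leq_addr addKn /= -gt // vr eqxx.
  by rewrite (_ : p + r == p = false) //; lia.
split=> x.
  have [/lt //|le_px] := ltnP x p; have [->//|nxp] := eqVneq x p.
  by rewrite pu.2 ?pu'.2 //; lia.
by case: x => // x; apply: gt.
Qed.

Lemma glue_permle p m u v : glueable p m u v -> permle (p + m) (glue p u v).
Proof.
move=> gl; have [pu up pv v0] := gl.
have [V [_ eV ltV]] := red_exists pv.
have gl' : glueable p m u (act V) by split=> //; rewrite ?eV //; apply: act_permle.
have [s [a [b [sp ra ea eg]]]] := glue_word_left gl'.
have lab : all (fun i => i < p) (a ++ s :: b).
  by apply: red_lt => //; split=> [|x lt_px]; [exact: act_inj|rewrite ea; apply: pu.2].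
have [inj_g fix_g] : permle (p + m) (act ((a ++ [:: s]) ++ shift p V ++ s :: b)).
  apply: act_permle; move: lab; rewrite !all_cat /= all_map => /andP[la /andP[ls lb]].
  rewrite (_ : s < p + m); last by lia.
  rewrite (all_ltW la) ?(all_ltW lb) ?andbT /=; [|lia|lia].
  by apply: sub_all ltV => i /=; lia.
have eg' := fun x => etrans (eg x) (eq_glue p (frefl u) eV x).
by split=> [x y|x lt]; rewrite -!eg'; [apply: inj_g|apply: fix_g].
Qed.

(** The 1 is the surplus of the braid [s s' s] over one [s] in [U] and one [s'] in [V]. *)
Lemma glue_minimal p m u v W : glueable p m u v -> red W -> act W =1 glue p u v ->
  exists U V, [/\ red U, red V, act U =1 u, act V =1 v & size W <= size U + size V + 1].
Proof.
move=> gl rW eW; have [pu up pv v0] := gl.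
have [V [rV eV ltV]] := red_exists pv.
have gl' : glueable p m u (act V) by split=> //; rewrite ?eV //; apply: act_permle.
have [s [a [b [sp ra ea eg]]]] := glue_word_left gl'.
exists (a ++ s :: b), V; split=> //.
have eW' : act ((a ++ [:: s]) ++ shift p V ++ s :: b) =1 act W.
  by move=> x; rewrite eg eW; apply: eq_glue.
apply: leq_trans (red_min rW eW') _.
by rewrite !(size_cat, size_map) /= ?(size_cat, size_map) /=; lia.
Qed.

Lemma glue_red p m U V W : red W -> glueable p m (act U) (act V) ->
  act W =1 glue p (act U) (act V) -> size W = size U + size V + 1 -> red U /\ red V.
Proof.
move=> rW gl eW sW; have [U' [V' [rU rV eU eV le_W]]] := glue_minimal gl rW eW.
have leU : size U' <= size U by apply: red_min => // x; rewrite eU.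
have leV : size V' <= size V by apply: red_min => // x; rewrite eV.
split; [apply: (min_red rU) => [x|]|apply: (min_red rV) => [x|]]; rewrite ?eU ?eV //; lia.
Qed.

(** * Pivots of a glued permutation *)

Lemma glueable_preim p m u v : glueable p m u v -> exists l r,
  [/\ l < p, u l = p, 0 < r & v r = 0].
Proof.
move=> [pu up pv v0]; have [l ul] := permle_surj p pu; have [r vr] := permle_surj 0 pv.
exists l, r; split=> //.
- have := permle_lt l pu; rewrite ul leqnn => /esym; rewrite leq_eqVlt => /predU1P[E|//].
  by case: up; rewrite -{1}E.
- by rewrite lt0n; apply/eqP => E; apply: v0; rewrite -{1}E.
Qed.

Lemma glueE p m u v l r : glueable p m u v -> u l = p -> v r = 0 ->
  [/\ forall x, x < p -> x <> l -> glue p u v x = u x /\ u x < p,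
      forall x, 0 < x -> x <> r -> glue p u v (p + x) = p + v x /\ 0 < v x,
      l < p /\ glue p u v l = p + v 0, 0 < r /\ glue p u v (p + r) = u p &
      [/\ glue p u v p = p, u p < p & 0 < v 0]].
Proof.
move=> gl ul vr; have [pu up pv v0] := gl.
have [l' [r' [lt_l ul' gt_r vr']]] := glueable_preim gl.
have el : l' = l by apply: pu.1; rewrite ul.
have er : r' = r by apply: pv.1; rewrite vr.
subst l' r'; rewrite /glue; split=> [x lt_xp nx|x gt_x nx|||].
- rewrite lt_xp; have := permle_lt x pu; have := pu.1 x l; case: eqP; lia.
- rewrite ltnNge leq_addr addKn /= (_ : p + x == p = false); last by lia.
  have := pv.1 x r; case: eqP; lia.
- by split=> //; rewrite lt_l ul eqxx.
- by split=> //; rewrite ltnNge leq_addr addKn /= (_ : p + r == p = false) ?vr //; lia.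
- rewrite ltnn eqxx; split=> //; last by lia.
  by have := permle_lt p pu; lia.
Qed.

Section Glue.
Variables (p m : nat) (u v : nat -> nat).
Hypothesis gl : glueable p m u v.
Local Notation w := (glue p u v).

Lemma inv_glue_left x y : x < p -> y < p -> inv w x y = inv u x y.
Proof.
move=> lx ly; have [l [r [lt_l ul gt_r vr]]] := glueable_preim gl.
have [w1 w2 [_ w3] [_ w4] [w5 w6 w7]] := glueE gl ul vr; rewrite /inv.
have [->|nx] := eqVneq x l; have [->|ny] := eqVneq y l; rewrite ?ul ?w3 //.
- by rewrite !ltnn.
- by have := w1 y ly (elimN eqP ny); lia.
- by have := w1 x lx (elimN eqP nx); lia.
- by have := w1 x lx (elimN eqP nx); have := w1 y ly (elimN eqP ny); lia.
Qed.

Lemma inv_glue_right x y : 0 < x -> 0 < y -> inv w (p + x) (p + y) = inv v x y.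
Proof.
move=> lx ly; have [l [r [lt_l ul gt_r vr]]] := glueable_preim gl.
have [w1 w2 [_ w3] [_ w4] [w5 w6 w7]] := glueE gl ul vr; rewrite /inv.
have [->|nx] := eqVneq x r; have [->|ny] := eqVneq y r; rewrite ?vr ?w4 //.
- by rewrite !ltnn.
- by have := w2 y ly (elimN eqP ny); lia.
- by have := w2 x lx (elimN eqP nx); lia.
- by have := w2 x lx (elimN eqP nx); have := w2 y ly (elimN eqP ny); lia.
Qed.

(** Only the strand going up, from [l], and the one coming down, from [p + r], take part in
    inversions across [p]. *)
Lemma inv_glue_cross x y l r : u l = p -> v r = 0 -> x < p -> 0 < y ->
  inv w x (p + y) = ((x == l) && inv v 0 y) || ((y == r) && inv u x p).
Proof.
move=> ul vr lx ly.
have [w1 w2 [lt_l w3] [gt_r w4] [w5 w6 w7]] := glueE gl ul vr; rewrite /inv.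
have [->|nx] := eqVneq x l; have [->|ny] := eqVneq y r; rewrite ?vr ?ul ?w4 ?w3 /=.
- lia.
- by have := w2 y ly (elimN eqP ny); lia.
- by have := w1 x lx (elimN eqP nx); lia.
- by have := w1 x lx (elimN eqP nx); have := w2 y ly (elimN eqP ny); lia.
Qed.

Lemma inv_glue_p l r : u l = p -> v r = 0 ->
  (forall x, inv w x p = (x == l)) /\ (forall y, inv w p y = (y == p + r)).
Proof.
move=> ul vr; have [w1 w2 [lt_l w3] [gt_r w4] [w5 w6 w7]] := glueE gl ul vr.
rewrite /inv; split=> [x|y]; rewrite w5.
  have [->|nx] := eqVneq x l; first by lia.
  have [lt_x|//] := ltnP x p; have := w1 x lt_x (elimN eqP nx); lia.
have [->|ny] := eqVneq y (p + r); first by lia.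
have [lt_y|//] := ltnP p y; have [||] := w2 (y - p); [lia|by move=> E; lia|].
by rewrite (_ : p + (y - p) = y); lia.
Qed.

Lemma pivot_glue : pivot w p.
Proof.
have [l [r [lt_l ul gt_r vr]]] := glueable_preim gl.
have [El Er] := inv_glue_p ul vr.
by exists l, (p + r); split; rewrite ?El ?Er // => x; rewrite ?El ?Er => /eqP.
Qed.

(* The positions of [u] are those of [w] below [p], followed by the position
   where [w] takes the value [u p]; similarly for [v]. *)
Definition posl r x := if x == p then p + r else x.
Definition posr l x := if x == 0 then l else p + x.

Lemma inv_posl r x y : v r = 0 -> x < p -> inv u x y -> inv w x (posl r y).
Proof.
move=> vr lx uxy; have [pu _ _ _] := gl.
have [l [r' [lt_l ul gt_r vr']]] := glueable_preim gl.
have er : r' = r by case: gl => _ _ [vi _] _; apply: vi; rewrite vr.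
subst r'; rewrite /posl; have [ey|ny] := eqVneq y p.
  by rewrite (inv_glue_cross ul vr) // eqxx -ey uxy orbT.
rewrite inv_glue_left //; have := permle_lt x pu.
by case: (ltnP y p) => // le_py; have := pu.2 y; move: uxy; rewrite /inv; lia.
Qed.

Lemma posl_inv r a x y : v r = 0 -> x < p -> inv w a x -> inv w x y ->
  exists2 y', y = posl r y' & inv u x y'.
Proof.
move=> vr lx wax wxy.
have [l [r' [lt_l ul gt_r vr']]] := glueable_preim gl.
have er : r' = r by case: gl => _ _ [vi _] _; apply: vi; rewrite vr.
subst r'; have [pu _ _ _] := gl.
(* As [u l = p] is the maximum of [u], no larger entry precedes position [l]; but [a] is one that
   precedes [x]. *)
have xl : x <> l.
  move=> exl; have lt_ax : a < x by move: wax; rewrite /inv => /andP[].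
  move: wax; rewrite inv_glue_left //; last by lia.
  rewrite /inv exl ul.
  by have := permle_lt a pu; lia.
have [lt_yp|le_py] := ltnP y p.
  by exists y; [rewrite /posl (_ : y == p = false) //; lia|rewrite -inv_glue_left].
have [eyp|nyp] := eqVneq y p.
  by move: wxy; rewrite eyp (inv_glue_p ul vr).1 => /eqP.
move: wxy; rewrite -(subnKC le_py) (inv_glue_cross ul vr) //; last by lia.
case/orP=> /andP[/eqP e1 e2] //; exists p => //.
by rewrite /posl eqxx e1.
Qed.

Lemma inv_posr l x y : u l = p -> 0 < y -> inv v x y -> inv w (posr l x) (p + y).
Proof.
move=> ul ly vxy.
have [l' [r [lt_l ul' gt_r vr]]] := glueable_preim gl.
have er : l' = l by case: gl => [[ui _]] _ _ _; apply: ui; rewrite ul.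
subst l'; rewrite /posr; have [ex|nx] := eqVneq x 0.
  by rewrite (inv_glue_cross ul vr) // eqxx -ex vxy.
by rewrite inv_glue_right //; lia.
Qed.

Lemma posr_inv l x y c : u l = p -> 0 < y -> inv w x (p + y) -> inv w (p + y) c ->
  exists2 x', x = posr l x' & inv v x' y.
Proof.
move=> ul ly wxy wyc.
have [l' [r [lt_l ul' gt_r vr]]] := glueable_preim gl.
have er : l' = l by case: gl => [[ui _]] _ _ _; apply: ui; rewrite ul.
subst l'; have yr : y <> r.
  move=> eyr; have lt_c : p + y < c by move: wyc; rewrite /inv => /andP[].
  move: wyc; rewrite -(subnKC (_ : p <= c)); last by lia.
  by rewrite inv_glue_right; [rewrite /inv eyr vr|lia..]; lia.
have [lt_xp|le_px] := ltnP x p.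
  move: wxy; rewrite (inv_glue_cross ul vr) // => /orP[] /andP[/eqP e1 e2] //.
  by exists 0.
have [exp|nxp] := eqVneq x p.
  by move: wxy; rewrite exp (inv_glue_p ul vr).2 eqn_add2l => /eqP.
exists (x - p); first by rewrite /posr (_ : x - p == 0 = false); lia.
by move: wxy; rewrite -{1}(subnKC le_px) inv_glue_right //; lia.
Qed.

Lemma inv_glue_right' x y : 0 < x -> inv w (p + x) y -> exists2 y', y = p + y' & inv v x y'.
Proof.
move=> lx wxy; have lt_xy : p + x < y by move: wxy; rewrite /inv => /andP[].
exists (y - p); first by lia.
by rewrite -inv_glue_right ?subnKC //; lia.
Qed.

Lemma pivot_glue_left q : q < p -> pivot w q <-> pivot u q.
Proof.
move=> lt_qp; have [l [r [lt_l ul gt_r vr]]] := glueable_preim gl.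
have posl_inj : {in [pred x | x <= p] &, injective (posl r)}.
  by move=> x y; rewrite !inE /posl; case: eqP; case: eqP; lia.
have le_p x : inv u q x -> x <= p.
  case: gl => pu _ _ _; have := permle_lt q pu; have := pu.2 x; rewrite /inv.
  by case: (ltnP p x) => //; lia.
split=> [] [a [c [ia ic ua uc]]].
  have lt_aq : a < q by move: ia; rewrite /inv => /andP[].
  have [c' ec ic'] := posl_inv vr lt_qp ia ic.
  exists a, c'; split=> // [|x ix|x ix].
  - by rewrite -inv_glue_left //; lia.
  - by apply: ua; rewrite inv_glue_left //; move: ix; rewrite /inv; lia.
  - by apply: posl_inj; rewrite ?inE ?le_p // -ec; apply: uc; apply: inv_posl.
have lt_aq : a < q by move: ia; rewrite /inv => /andP[].
have wa : inv w a q by rewrite inv_glue_left //; lia.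
exists a, (posl r c); split=> // [|x ix|x ix].
- exact: inv_posl.
- by apply: ua; rewrite -inv_glue_left //; move: ix; rewrite /inv; lia.
- by have [x' -> /uc->] := posl_inv vr lt_qp wa ix.
Qed.

Lemma pivot_glue_right q : 0 < q -> pivot w (p + q) <-> pivot v q.
Proof.
move=> gt_q; have [l [r [lt_l ul gt_r vr]]] := glueable_preim gl.
have posr_inj : injective (posr l).
  by move=> x y; rewrite /posr; case: eqP; case: eqP; lia.
split=> [] [a [c [ia ic ua uc]]].
  have [a' ea ia'] := posr_inv ul gt_q ia ic.
  have [c' ec ic'] := inv_glue_right' gt_q ic.
  exists a', c'; split=> // x ix.
  - by apply: posr_inj; rewrite -ea; apply: ua; apply: inv_posr.
  - apply/eqP; rewrite -(eqn_add2l p) -ec; apply/eqP/uc; rewrite inv_glue_right //.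
    by move: ix; rewrite /inv; lia.
have wc : inv w (p + q) (p + c) by rewrite inv_glue_right //; move: ic; rewrite /inv; lia.
exists (posr l a), (p + c); split=> // [|x ix|x ix].
- exact: inv_posr.
- by have [x' -> /ua->] := posr_inv ul gt_q ix wc.
- by have [y -> /uc->] := inv_glue_right' gt_q ix.
Qed.
End Glue.

(** * 321 patterns of a glued permutation *)

Definition no321 f := forall a b c, inv f a b -> inv f b c -> False.

Definition clustered f := forall a b c, inv f a b -> inv f b c -> pivot_with f b a c.

Lemma no321_clustered f : no321 f -> clustered f.
Proof. by move=> nf a b c ab bc; case: (nf _ _ _ ab bc). Qed.

Lemma no321_pivot f q : no321 f -> ~ pivot f q.
Proof. by move=> nf [a [c [ia ic _ _]]]; apply: nf ia ic. Qed.

Lemma clustered_no321 f : clustered f -> (forall q, ~ pivot f q) -> no321 f.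
Proof. by move=> cf np a b c ab bc; apply: (np b); exists a, c; apply: cf. Qed.

(** Pivots of the gluing below [p] are pivots of [u]. Hence [p] is the first pivot when [u] has
    none, and a clustered [u] without pivots avoids 321. *)
Lemma glue_clustered p m u v : glueable p m u v ->
  clustered (glue p u v) /\ (forall q, q < p -> ~ pivot (glue p u v) q) <->
  no321 u /\ clustered v.
Proof.
move=> gl; have [l [r [lt_l ul gt_r vr]]] := glueable_preim gl.
have [pu _ pv _] := gl.
split=> [[cw np]|[nu cv]]; last first.
  split=> [a b c ab bc|q lt_qp]; last by rewrite (pivot_glue_left gl lt_qp); apply: no321_pivot.
  case: (ltngtP b p) => [lt_bp|lt_pb|eb].
  - have [c' ec ic'] := posl_inv gl vr lt_bp ab bc; case: (nu a b c') => //.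
    by rewrite -(inv_glue_left gl) //; move: ab; rewrite /inv; lia.
  - move: ab bc; rewrite -(subnKC (ltnW lt_pb)); set b' := b - p => ab bc.
    have gt_b : 0 < b' by rewrite subn_gt0.
    have [a' ea ia'] := posr_inv gl ul gt_b ab bc.
    have [c' ec ic'] := inv_glue_right' gl gt_b bc.
    have [_ _ ua uc] := cv _ _ _ ia' ic'.
    split=> // x ix.
      by have [x' -> /ua->] := posr_inv gl ul gt_b ix bc.
    by have [y -> /uc->] := inv_glue_right' gl gt_b ix.
  - move: ab bc; rewrite eb => ab bc; have [El Er] := inv_glue_p gl ul vr.
    by split=> // x; move: ab bc; rewrite ?El ?Er => /eqP ea /eqP ec /eqP; rewrite ?ea ?ec.
split.
  move=> a b c ab bc.
  have le_b : b < p.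
    have := permle_lt b pu; have := permle_lt a pu; have := pu.2 c; have := pu.2 b.
    move: ab bc; rewrite /inv; case: (ltnP p c); case: (ltnP p b); lia.
  have wab : inv (glue p u v) a b by rewrite (inv_glue_left gl) //; move: ab; rewrite /inv; lia.
  apply: (np b le_b); exists a, (posl p r c); apply: cw => //.
  exact: (inv_posl gl).
move=> a b c ab bc; have gt_b : 0 < b by move: ab; rewrite /inv; lia.
have gt_c : 0 < c by move: bc; rewrite /inv; lia.
have wbc : inv (glue p u v) (p + b) (p + c) by rewrite (inv_glue_right gl).
have wab := inv_posr gl ul gt_b ab.
have [_ _ ua uc] := cw _ _ _ wab wbc; split=> // x ix.
  have := ua _ (inv_posr gl ul gt_b ix); rewrite /posr; case: eqP; case: eqP; lia.
have := uc (p + x); rewrite (inv_glue_right gl) //; last by move: ix; rewrite /inv; lia.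
by move=> /(_ ix); lia.
Qed.

(** * Factors of reduced words *)

(** This is commutation of generators, so [far i i] holds. *)
Definition far i j := (i.+1 != j) && (j.+1 != i).

Lemma act_swap i j x : far i j -> sw j (sw i x) = sw i (sw j x).
Proof. by rewrite /far; swlia. Qed.

Lemma act_far_cons s u : all (far s) u -> act (s :: u) =1 act (u ++ [:: s]).
Proof.
elim: u => //= i u IHu /andP[fi /IHu E] x.
by rewrite act_swap // -E.
Qed.

Lemma act_far_mid a s b c : all (far s) b -> act (a ++ b ++ s :: c) =1 act (a ++ s :: b ++ c).
Proof.
move=> fb x; rewrite !act_cat /= act_cat.
by have := act_far_cons fb (act a x); rewrite act_cat /= => ->.
Qed.

(* A letter separated from its next occurrence by a word fixing both of the
   swapped points could be cancelled. *)
Lemma red_not_fix a s b c : red (a ++ s :: b ++ s :: c) -> act b s = s -> act b s.+1 <> s.+1.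
Proof.
move=> rW bs bs1.
suff E : act (a ++ b ++ c) =1 act (a ++ s :: b ++ s :: c).
  by have := red_min rW E; rewrite !size_cat /= size_cat /=; lia.
move=> x; rewrite !act_cat /= act_cat /=; congr (act c); move: (act a x) => y.
have [->|n1] := eqVneq y s; first by rewrite bs /sw eqxx bs1; swlia.
have [->|n2] := eqVneq y s.+1.
  by rewrite bs1 (_ : sw s s.+1 = s) ?bs; swlia.
rewrite (_ : sw s y = y); last by swlia.
have := @act_inj b y s; have := @act_inj b y s.+1; rewrite bs bs1; swlia.
Qed.

Lemma size_low_high p u : size (low p u) + size (high p u) = size u.
Proof.
rewrite size_map !size_filter -[RHS](count_predC (fun i => i < p)); congr addn.
by apply: eq_count => i /=; lia.
Qed.

Lemma glueable_words n p u v : all (fun i => i < n) v -> p <= n ->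
  act (low p u) p <> p -> act (high p v) 0 <> 0 ->
  glueable p (n - p) (act (low p u)) (act (high p v)).
Proof.
move=> ltv le_pn up v0; split=> //; apply: act_permle; first exact: filter_all.
rewrite all_map; apply/allP => i; rewrite mem_filter => /andP[le_pi /(allP ltv)] /=; lia.
Qed.

(** Every reduced word of a permutation with a pivot is cut into reduced words of its two parts by
    deleting one of the outer letters [s]. Both choices are provided, so that a letter outside a
    given factor can be deleted later. *)
Lemma pivot_split n W p : red W -> permle n (act W) -> pivot (act W) p ->
  exists s a b c,
    [/\ W = a ++ s :: b ++ s :: c, (s == p) || (s.+1 == p), free p a && free p c, free (sw s p) b &
        forall W', W' = a ++ s :: b ++ c \/ W' = a ++ b ++ s :: c ->
        [/\ red (low p W'), red (high p W'),
            glueable p (n - p) (act (low p W')) (act (high p W')) &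
            act W =1 glue p (act (low p W')) (act (high p W'))]].
Proof.
move=> rW pW piv; have ltW := red_lt rW pW.
have [s [a [b [c [eW sp fa fc fb]]]]] := pivot_word rW piv.
exists s, a, b, c; split=> //; first exact/andP.
have le_pn : p <= n.
  have [l [r [_ ir _ _]]] := piv; rewrite leqNgt; apply/negP => lt_np.
  have lt_nr : n < r by apply: ltn_trans lt_np _; case/andP: ir.
  by move: ir; rewrite /inv pW.2 // pW.2 //; lia.
have sizeW' W' : W' = a ++ s :: b ++ c \/ W' = a ++ b ++ s :: c -> size W = size W' + 1.
  by rewrite eW; case=> ->; rewrite !size_cat /= !size_cat /=; lia.
have ltW' W' : W' = a ++ s :: b ++ c \/ W' = a ++ b ++ s :: c -> all (fun i => i < n) W'.
  by move=> eW'; move: ltW; rewrite eW; case: eW' => ->; rewrite !all_cat /= !all_cat /=; lia.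
(* It suffices to treat the deletion of the second [s], because deleting the first one moves [s]
   past letters commuting with it in the part that contains [s], and does not affect the other part.
   The lengths then give reducedness by [glue_red]. *)
suff [E1 E2] : (forall W', W' = a ++ s :: b ++ c \/ W' = a ++ b ++ s :: c ->
    act (low p W') =1 act (low p (a ++ s :: b ++ c)) /\
    act (high p W') =1 act (high p (a ++ s :: b ++ c))) /\
    [/\ act (low p (a ++ s :: b ++ c)) p <> p, act (high p (a ++ s :: b ++ c)) 0 <> 0 &
        act W =1 glue p (act (low p (a ++ s :: b ++ c))) (act (high p (a ++ s :: b ++ c)))].
  move=> W' eW'; have [u0 v0 eg] := E2; have [eu ev] := E1 W' eW'.
  have gl : glueable p (n - p) (act (low p W')) (act (high p W')).
    by apply: glueable_words; rewrite ?eu ?ev //; apply: ltW'.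
  have eg' : act W =1 glue p (act (low p W')) (act (high p W')).
    by move=> x; rewrite eg; apply: eq_glue => y.
  have [|rl rh] := glue_red rW gl eg'; last by split.
  by rewrite size_low_high; apply: sizeW'.
case/orP: sp => /eqP sp.
  subst s; have fb' : free p.+1 b by move: fb; rewrite /sw eqxx.
  have nb : all (fun i => i != p) b by apply: sub_all fb' => i; lia.
  have [b1 b2 b3] := act_split_above nb.
  have [a1 a2 a3] := act_split_above (free_above fa).
  have [c1 c2 c3] := act_split_above (free_above fc).
  have pb := free_act fb'.
  (* Otherwise [b] would fix both points swapped by [s], and the two occurrences of [s] would
     cancel. *)
  have up : act (low p (a ++ b ++ c)) p <> p.
    rewrite !low_cat !act_cat -(a1 p (leqnn p)).1 (free_act fa) -(b1 p (leqnn p)).1.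
    rewrite -(c1 _ (b1 p (leqnn p)).2).1 => E.
    have bp : act b p = p by apply: (@act_inj c); rewrite E (free_act fc).
    by move: rW; rewrite eW => /red_not_fix /(_ bp).
  have el x y : low p (x ++ p :: y) = low p (x ++ y).
    by rewrite !low_cat /low /= ltnn.
  have eh x y : high p (x ++ p :: y) = high p x ++ 0 :: high p y.
    by rewrite high_cat /high /= leqnn /= subnn.
  split=> [W' eW'|].
    split=> x; first by case: eW' => -> //; rewrite el [in LHS]catA el -catA.
    case: eW' => -> //; rewrite [in LHS]catA !eh !high_cat -catA; apply: act_far_mid.
    rewrite /high all_map; apply/allP => i; rewrite mem_filter => /andP[le_pi ib] /=.
    by have := allP nb i ib; have := allP fb' i ib; rewrite /far; lia.
  split; first by rewrite el.
    have hb1 : act (high p b) 1 = 1 by have := (b2 p.+1 (ltnSn p)).1; rewrite pb subSnn; lia.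
    by rewrite eh high_cat !act_cat /= act_cat a3 hb1 -[in X in _ <> X]c3 => /act_inj.
  by move=> x; rewrite eW (glue_word_above fa fb' fc) // el.
have fb' : free s b by move: fb; rewrite (_ : sw s p = s) //; swlia.
have nb : all (fun i => i.+1 != p) b by apply: sub_all fb' => i; lia.
have [b1 b2 b3] := act_split_below nb.
have [a1 a2 a3] := act_split_below (free_below fa).
have [c1 c2 c3] := act_split_below (free_below fc).
have sb := free_act fb'; have pa := free_act fa; have pc := free_act fc.
have sw_sp : sw s p = s by swlia.
have a0 : act (high p a) 0 = 0 by have := a2 p; rewrite subnn pa; lia.
have c0 : act (high p c) 0 = 0 by have := c2 p; rewrite subnn pc; lia.
have v0 : act (high p (a ++ b ++ c)) 0 <> 0.
  rewrite !high_cat !act_cat a0 -{2}c0 => /act_inj b0.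
  have bp : act b p = p by rewrite b2 // subnn b0 addn0.
  by move: rW; rewrite eW => /red_not_fix /(_ sb); rewrite sp.
have eh x y : high p (x ++ s :: y) = high p (x ++ y).
  by rewrite !high_cat /high /= leqNgt -sp ltnSn.
have el x y : low p (x ++ s :: y) = low p x ++ s :: low p y.
  by rewrite low_cat /low /= -{2}sp ltnSn.
split=> [W' eW'|].
  split=> x; last by case: eW' => -> //; rewrite eh [in LHS]catA eh -catA.
  case: eW' => -> //; rewrite [in LHS]catA !el !low_cat -catA; apply: act_far_mid.
  apply/allP => i; rewrite mem_filter => /andP[lt_ip ib] /=.
  by have := allP fb' i ib; rewrite /far; lia.
split; last by move=> x; rewrite eW (glue_word_below sp fa fb' fc) // eh.
  have lt_sp : s < p by lia.
  rewrite el low_cat act_cat a3 /= act_cat sw_sp -(b1 s lt_sp).1 sb -(c1 s lt_sp).1.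
  by have := (c1 s lt_sp).2; lia.
by rewrite eh.
Qed.

(** Cutting a reduced word of the gluing yields words for [u] and [v] at least as long as [U] and
    [V], so [X] is no longer than that reduced word. *)
Lemma glue_word_red p m u v U V X : glueable p m u v -> red U -> red V ->
  act U =1 u -> act V =1 v -> act X =1 glue p u v -> size X = size U + size V + 1 -> red X.
Proof.
move=> gl rU rV eU eV eX sX; have pw := glue_permle gl.
have [W [rW eW ltW]] := red_exists pw.
have pW : permle (p + m) (act W) by apply: act_permle.
have pivW : pivot (act W) p.
  have [l [r [h1 h2 h3 h4]]] := pivot_glue gl.
  by exists l, r; split=> [||x|x]; rewrite /inv !eW //; [apply: h3|apply: h4].
have [s [a [b [c [eWs _ _ _ /(_ (a ++ s :: b ++ c)) []]]]]] := pivot_split rW pW pivW.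
  by left.
set W' := a ++ s :: b ++ c => rl rh; rewrite addKn => gl' eg.
have [|eu ev] := glue_inj gl gl'; first by move=> x; rewrite -eg eW.
have leU : size U <= size (low p W') by apply: red_min => // x; rewrite -eu eU.
have leV : size V <= size (high p W') by apply: red_min => // x; rewrite -ev eV.
apply: (min_red rW) => [x|]; first by rewrite eX eW.
have sW' : size (low p W') + size (high p W') + 1 = size W.
  by rewrite size_low_high eWs /W' !size_cat /= !size_cat /=; lia.
by rewrite sX -sW'; lia.
Qed.

(** The lower neighbour is expressed by [e.+1 = c], which cannot hold for [c = 0]: then 0 occurs at
    most once. In general the lowest and the highest letter of [h] occur at most once. *)
Definition gap h := forall x c z y, h = x ++ c :: z ++ c :: y -> c \notin z ->
  (exists2 e, e \in z & e.+1 = c) /\ c.+1 \in z.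

(* [b] is the last column of the heap; single columns are treated apart in [good_set]. *)
Definition good_word v := exists b,
  [/\ 1 < b, all (fun i => i <= b) v, forall c, 0 < c < b -> 2 <= count_mem c v & gap v].

Definition contains (P : seq nat -> Prop) f := exists v x y d,
  [/\ P v, red (x ++ shift d v ++ y) & act (x ++ shift d v ++ y) =1 f].

Lemma first_occ (s : nat) u : s \in u -> exists x y, u = x ++ s :: y /\ s \notin x.
Proof.
elim: u => //= i u IHu; have [->|ni] := eqVneq i s; first by exists [::], u.
rewrite inE eq_sym (negPf ni) => /IHu[x [y [-> nx]]].
by exists (i :: x), y; rewrite inE eq_sym negb_or ni nx.
Qed.

Lemma first_two (s : nat) u : 2 <= count_mem s u ->
  exists x z y, u = x ++ s :: z ++ s :: y /\ s \notin z.
Proof.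
move=> c2; have [|x [u1 [eu nx]]] := @first_occ s u; first by rewrite -has_pred1 has_count; apply: leq_trans c2.
move: c2; rewrite eu count_cat /= eqxx (count_memPn nx) add0n add1n ltnS => c1.
have [|z [y [eu1 nz]]] := @first_occ s u1; first by rewrite -has_pred1 has_count.
by exists x, z, y; rewrite eu1.
Qed.

Lemma first_occ_uniq (s : nat) x y x' y' : x ++ s :: y = x' ++ s :: y' ->
  s \notin x -> s \notin x' -> x = x' /\ y = y'.
Proof.
elim: x x' => [|i x IHx] [|j x'] //=; try by [case=> ->; rewrite inE eqxx|case=> <-; rewrite inE eqxx].
  by case=> ->.
case=> -> E; rewrite !inE !negb_or => /andP[_ nx] /andP[_ nx'].
by have [-> ->] := IHx _ E nx nx'.
Qed.

Lemma occ_cases (s : nat) a b c l r : a ++ s :: b ++ s :: c = l ++ s :: r ->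
  s \notin a -> s \notin b -> s \notin c ->
  (l = a /\ r = b ++ s :: c) \/ (l = a ++ s :: b /\ r = c).
Proof.
move=> E na nb nc; have [sl|nl] := boolP (s \in l); last first.
  by left; have [-> ->] := first_occ_uniq E na nl.
have [l1 [l2 [el nl1]]] := first_occ sl.
move: E; rewrite el -catA /= => /first_occ_uniq /(_ na nl1)[-> E].
have [sl2|nl2] := boolP (s \in l2).
  have [l3 [l4 [el2 nl3]]] := first_occ sl2.
  move: E; rewrite el2 -catA /= => /first_occ_uniq /(_ nb nl3)[_ E].
  by move: nc; rewrite E mem_cat inE eqxx orbT.
by have [-> ->] := first_occ_uniq E nb nl2; right.
Qed.

Lemma gap_shift d v : gap v -> gap (shift d v).
Proof.
move=> gv x c z y E nc.
have shK : [seq i - d | i <- shift d v] = v.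
  by rewrite -map_comp -[RHS]map_id; apply: eq_map => i /=; rewrite addKn.
have le i : i \in shift d v -> d <= i by case/mapP => j _ ->; apply: leq_addr.
have lez i : i \in z -> d <= i.
  by move=> iz; apply: le; rewrite E mem_cat inE mem_cat iz !orbT.
have lec : d <= c by apply: le; rewrite E mem_cat inE eqxx orbT.
have Ev : v = [seq i - d | i <- x] ++ (c - d) :: [seq i - d | i <- z] ++ (c - d) :: [seq i - d | i <- y].
  by rewrite -[LHS]shK E map_cat /= map_cat.
have [|[e ez eE] cz] := gv _ _ _ _ Ev.
  by apply/mapP => -[i iz]; have := lez i iz => ? ?; case/negP: nc; rewrite (_ : c = i) //; lia.
split.
  by case/mapP: ez => i iz ei; exists i => //; have := lez i iz; lia.
by case/mapP: cz => i iz ei; rewrite (_ : c.+1 = i) //; have := lez i iz; lia.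
Qed.

Lemma low_shift_id p d b v : all (fun i => i <= b) v -> d + b < p -> low p (shift d v) = shift d v.
Proof.
move=> lev lt; apply: low_id; rewrite all_map; apply: sub_all lev => i /=; lia.
Qed.

Lemma high_shift_id p d v : p <= d -> high p (shift d v) = shift (d - p) v.
Proof.
move=> le_pd; rewrite /high (_ : [seq i <- _ | _] = shift d v).
  by rewrite /shift -map_comp; apply: eq_map => i /=; lia.
by apply/all_filterP; rewrite all_map; apply/allP => i _ /=; lia.
Qed.

Lemma count_shift d c v : d <= c -> count_mem c (shift d v) = count_mem (c - d) v.
Proof. by move=> le_dc; rewrite count_map; apply: eq_count => i /=; lia. Qed.

Lemma free_mem x i u : free x u -> i \in u -> i <> x /\ i.+1 <> x.
Proof. by move=> fu /(allP fu)/andP[/eqP n1 /eqP n2]. Qed.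

Lemma contains_split n P v x y d p :
  let W := x ++ shift d v ++ y in
  red W -> permle n (act W) -> pivot (act W) p -> P v -> good_word v ->
  exists u1 u2, [/\ glueable p (n - p) u1 u2, act W =1 glue p u1 u2 &
                    contains P u1 \/ contains P u2].
Proof.
move=> W rW pW piv Pv [b [b1 lev two gapv]]; set h := shift d v.
have gaph : gap h by apply: gap_shift.
have twoh c : d < c -> c < d + b -> 2 <= count_mem c h.
  by move=> h1 h2; rewrite count_shift; [apply: two|]; lia.
have [s [A [B [C [eW sp /andP[fA fC] fB remove]]]]] := pivot_split rW pW piv.
have {}sp : s = p \/ s.+1 = p by case/orP: sp => /eqP; [left|right].
have nA : s \notin A by apply/negP => /(free_mem fA)[]; case: sp.
have nC : s \notin C by apply/negP => /(free_mem fC)[]; case: sp.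
have memB i : i \in B -> [/\ i <> s, s = p -> i <> p.+1 & s.+1 = p -> i.+1 <> s].
  case/(free_mem fB); case: sp => <-; rewrite /sw ?eqxx.
    by move=> n1 n2; split=> // [e|e _]; [apply: n2; rewrite e|case: (n_Sn s)].
  by rewrite (_ : s.+1 == s = false) => [n1 n2|]; [split=> // /n_Sn|clear; lia].
have nB : s \notin B by apply/negP => /memB[].
(* Two occurrences of [s] in [h] would be the two of [W], with [B] between them, and [gap] would put
   both neighbours of [s] into [B]; but [B] avoids the letters that move the wire [p], which runs
   through [B] at [sw s p]. *)
have one_s : count_mem s h <= 1.
  rewrite leqNgt; apply/negP => /first_two[X [Z [Y [eh nZ]]]].
  have [[e eZ es] sZ] := gaph _ _ _ _ eh nZ.
  have := eW; rewrite /W -/h eh -!catA /= -catA => /esym E.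
  have := occ_cases (_ : A ++ s :: B ++ s :: C = (x ++ X) ++ s :: Z ++ s :: Y ++ y) nA nB nC.
  rewrite -catA /= -E => /(_ erefl)[[_ /first_occ_uniq /(_ nZ nB)[eZB _]]|[_ eC]].
    rewrite eZB in eZ sZ; have [_ _ n1] := memB _ eZ; have [_ n2 _] := memB _ sZ.
    by case: sp => sp; [case: n2; rewrite ?sp|case: n1].
  by move: nC; rewrite -eC mem_cat inE eqxx orbT.
(* Let [t] be the other one of the letters [p.-1] and [p]. As [1 < b], one of [s] and [t] is an
   internal column of [h], and it is [t] by [one_s]. So [h] contains two [t] with an [s] between
   them, whereas in [W] all [t] lie between the two [s]. *)
have not_across : d < p -> p <= d + b -> False.
  move=> lt_dp le_p.
  have [t t_cases] : exists t, (s = p /\ t.+1 = p) \/ (s.+1 = p /\ t = p).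
    by case: sp => sp; [exists p.-1; left; move: lt_dp sp; clear; lia|exists p; right].
  have nsi : ~ (d < s < d + b) by move=> /andP[/twoh h1 /h1]; rewrite ltnNge one_s.
  have /andP[dt td] : d < t < d + b by move: nsi t_cases lt_dp le_p b1; clear; lia.
  have [X [Z [Y [eh nZ]]]] := first_two (twoh t dt td).
  have [[e eZ et] tZ] := gaph _ _ _ _ eh nZ.
  have sZ : s \in Z.
    case: t_cases => -[e1 e2]; first by rewrite e1 -e2.
    by rewrite (_ : s = e) //; move: e1 e2 et; clear; lia.
  have [Z1 [Z2 [eZ12 _]]] := first_occ sZ.
  have tA : t \notin A by apply/negP => /(free_mem fA)[]; case: t_cases => -[].
  have tC : t \notin C by apply/negP => /(free_mem fC)[]; case: t_cases => -[].
  have := occ_cases (_ : A ++ s :: B ++ s :: C =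
    (x ++ X ++ t :: Z1) ++ s :: Z2 ++ t :: Y ++ y) nA nB nC.
  rewrite -eW /W -/h eh eZ12 -!catA /= -!catA /= -!catA /= => /(_ erefl)[[eA _]|[_ eC]].
    by move: tA; rewrite -eA !mem_cat inE eqxx !orbT.
  by move: tC; rewrite -eC !mem_cat inE eqxx !orbT.
have done_with W' x' y' : W' = A ++ s :: B ++ C \/ W' = A ++ B ++ s :: C ->
    W' = x' ++ h ++ y' -> exists u1 u2, [/\ glueable p (n - p) u1 u2, act W =1 glue p u1 u2 &
                    contains P u1 \/ contains P u2].
  move=> /remove[rl rh gl eg] eW'; exists (act (low p W')), (act (high p W')); split=> //.
  have [lt|ge] := ltnP (d + b) p; [left|right].
    exists v, (low p x'), (low p y'), d.
    by move: rl; rewrite eW' !low_cat (low_shift_id lev lt).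
  have le_pd : p <= d by rewrite leqNgt; apply/negP => lt; apply: not_across.
  exists v, (high p x'), (high p y'), (d - p).
  by move: rh; rewrite eW' !high_cat high_shift_id.
have cW : count_mem s W = 2.
  by rewrite eW count_cat /= count_cat /= eqxx (count_memPn nA) (count_memPn nB) (count_memPn nC).
have remove_at l r : W = l ++ s :: r -> l ++ r = A ++ s :: B ++ C \/ l ++ r = A ++ B ++ s :: C.
  rewrite eW => /occ_cases /(_ nA nB nC)[[-> ->]|[-> ->]]; [by right|left].
  by rewrite -catA.
(* Of the two [s] in [W] at most one is in [h]; deleting one outside [h] keeps the factor intact. *)
have [sx|sy] : s \in x \/ s \in y.
  apply/orP; rewrite -mem_cat -has_pred1 has_count count_cat.
  by move: cW; rewrite /W !count_cat -/h; lia.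
  have [x1 [x2 [ex _]]] := first_occ sx.
  apply: (done_with (x1 ++ x2 ++ h ++ y) (x1 ++ x2) y); last by rewrite -catA.
  by apply: remove_at; rewrite /W ex -catA.
have [y1 [y2 [ey _]]] := first_occ sy.
apply: (done_with ((x ++ h ++ y1) ++ y2) x (y1 ++ y2)); last by rewrite -!catA.
by apply: remove_at; rewrite /W ey -!catA.
Qed.

Lemma eq_contains P f g : f =1 g -> contains P f -> contains P g.
Proof.
by move=> E [v [x [y [d [Pv rW eW]]]]]; exists v, x, y, d; split=> // z; rewrite eW E.
Qed.

Lemma contains_nontrivial P n f x : P [:: 0] -> permle n f -> f x <> x -> contains P f.
Proof.
move=> P0 pf nx; have [[|i u] [ru eu _]] := red_exists pf; first by case: nx; rewrite -eu.
exists [:: 0], [::], u, i; rewrite /= addn0; split=> //.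
Qed.

Lemma pivot_eq f g p : f =1 g -> pivot f p -> pivot g p.
Proof.
move=> E [l [r [h1 h2 h3 h4]]].
by exists l, r; split=> [||x|x]; rewrite /inv -!E //; [apply: h3|apply: h4].
Qed.

(** If [P] contains a single generator, every permutation other than the identity contains [P], and
    both sides of [contains_glue] hold. *)
Definition good_set (P : seq nat -> Prop) := P [:: 0] \/ forall v, P v -> good_word v.

Lemma contains_glue P p m u v : good_set P -> glueable p m u v ->
  contains P (glue p u v) <-> contains P u \/ contains P v.
Proof.
move=> goodP gl; have [pu up pv v0] := gl; split.
  case: goodP => [P0 _|goodP]; first by left; exact: contains_nontrivial P0 pu up.
  case=> [w [x [y [d [Pw rW eW]]]]].
  have pW : permle (p + m) (act (x ++ shift d w ++ y)).
    by have [gi gf] := glue_permle gl; split=> [|z /gf]; [exact: act_inj|by rewrite eW].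
  have piv := pivot_eq (fsym eW) (pivot_glue gl).
  have [u1 [u2 []]] := contains_split rW pW piv Pw (goodP _ Pw).
  rewrite addKn => gl' eg cP; have [|e1 e2] := glue_inj gl gl'.
    by move=> z; rewrite -eg eW.
  by case: cP => cP; [left|right]; apply: eq_contains cP => z; rewrite ?e1 ?e2.
case=> [] [w [x [y [d [Pw rU eU]]]]].
  have glU : glueable p m (act (x ++ shift d w ++ y)) v.
    by split=> //; rewrite ?eU //; split=> [|z lt]; [exact: act_inj|rewrite eU; apply: pu.2].
  have ltU : all (fun i => i < p) (x ++ shift d w ++ y) by apply: red_lt => //; case: glU.
  have [a [b [rV eV eg]]] := glue_word_right glU ltU.
  have eg' := fun z => etrans (eg z) (eq_glue p eU (frefl v) z).
  exists w, ((shift p a ++ [:: p]) ++ x), (y ++ p :: shift p b), d.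
  have eqW : ((shift p a ++ [:: p]) ++ x) ++ shift d w ++ y ++ p :: shift p b =
      (shift p a ++ [:: p]) ++ (x ++ shift d w ++ y) ++ p :: shift p b by rewrite -!catA.
  rewrite eqW; split=> //; apply: (glue_word_red gl rU rV eU eV eg').
  by rewrite !(size_cat, size_map) /= ?(size_cat, size_map) /=; lia.
have glV : glueable p m u (act (x ++ shift d w ++ y)).
  by split=> //; rewrite ?eU //; split=> [|z lt]; [exact: act_inj|rewrite eU; apply: pv.2].
have [s [a [b [sp rV eV eg]]]] := glue_word_left glV.
have eg' := fun z => etrans (eg z) (eq_glue p (frefl u) eU z).
exists w, ((a ++ [:: s]) ++ shift p x), (shift p y ++ s :: b), (p + d).
have eqW : ((a ++ [:: s]) ++ shift p x) ++ shift (p + d) w ++ shift p y ++ s :: b =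
    (a ++ [:: s]) ++ shift p (x ++ shift d w ++ y) ++ s :: b.
  rewrite -!catA; congr (a ++ _ :: _); rewrite /shift !map_cat -map_comp -!catA.
  by congr (_ ++ (_ ++ _)); apply: eq_map => i /=; rewrite addnA.
rewrite eqW; split=> //; apply: (glue_word_red gl rV rU eV eU eg').
by rewrite !(size_cat, size_map) /= ?(size_cat, size_map) /=; lia.
Qed.

Lemma pivot_glueP n f p : permle n f -> pivot f p -> p <= n /\
  exists u v, glueable p (n - p) u v /\ f =1 glue p u v.
Proof.
move=> pf piv; have [W [rW eW ltW]] := red_exists pf.
have pW : permle n (act W) by apply: act_permle.
have [s [a [b [c [_ _ _ _ /(_ (a ++ s :: b ++ c)) []]]]]] :=
  pivot_split rW pW (pivot_eq (fsym eW) piv); first by left.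
move=> _ _ gl eg; split; last first.
  by do 2!eexists; split; first exact: gl; move=> x; rewrite -eW.
rewrite leqNgt; apply/negP => lt_np; have [l [r [_ ir _ _]]] := piv.
have lt_nr : n < r by apply: ltn_trans lt_np _; case/andP: ir.
by move: ir; rewrite /inv pf.2 // pf.2 //; lia.
Qed.

(** * Fully commutative permutations *)

Section Words.
Variable n : nat.
Implicit Types (w : 'S_n.+1) (u v : seq 'I_n).

Definition permfun w x := if x < n.+1 then val (w (inord x)) else x.

Lemma permfun_ord w (x : 'I_n.+1) : permfun w x = w x.
Proof. by rewrite /permfun ltn_ord inord_val. Qed.

Lemma permfun_inj w w' : permfun w =1 permfun w' -> w = w'.
Proof. by move=> E; apply/permP => x; apply: val_inj; rewrite /= -!permfun_ord. Qed.

Lemma permfun_permle w : permle n (permfun w).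
Proof.
split=> [x y|x lt_nx]; last by rewrite /permfun ltnNge lt_nx.
rewrite /permfun; case: ltnP => lt_x; case: ltnP => lt_y.
- by move/val_inj/perm_inj/(congr1 val); rewrite /= !inordK.
- by move=> /= E; have := ltn_ord (w (inord x)); rewrite E; lia.
- by move=> /= E; have := ltn_ord (w (inord y)); rewrite -E; lia.
- by [].
Qed.

Lemma val_gen (i : 'I_n) (x : 'I_n.+1) : gen i x = sw i x :> nat.
Proof.
rewrite /gen /sw; have [->|->|n1 n2] := tpermP (widen_ord (leqnSn n) i) (lift ord0 i) x.
- by rewrite /= eqxx.
- by rewrite /= /bump /= add1n (gtn_eqF (ltnSn i)) eqxx.
- case: eqP => [e|_]; first by case: n1; apply: val_inj.
  by case: eqP => [e|//]; case: n2; apply: val_inj; rewrite /= /bump /= add1n.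
Qed.

Lemma word_permE u : permfun (word_perm u) =1 act (map val u).
Proof.
move=> x; have [lt_x|le_x] := ltnP x n.+1; last first.
  rewrite /permfun ltnNge le_x /=; symmetry; apply: (@act_permle n _ _).2 => //.
  by rewrite all_map; apply/allP => i _ /=.
rewrite -[x]/(val (Ordinal lt_x)) permfun_ord; move: (Ordinal lt_x) => y {x lt_x}.
elim: u y => [|i u IHu] y; rewrite /word_perm ?big_nil ?perm1 // big_cons permM.
by rewrite [LHS]IHu /= val_gen.
Qed.

Lemma lift_word (U : seq nat) : all (fun i => i < n) U -> exists u, map val u = U.
Proof.
elim: U => [|i U IHU] /=; first by exists [::].
by case/andP=> lt_i /IHU[u <-]; exists (Ordinal lt_i :: u).
Qed.

Lemma reducedE w u : reduced w u <-> red (map val u) /\ act (map val u) =1 permfun w.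
Proof.
have [U [rU eU ltU]] := red_exists (permfun_permle w).
have wordE v : act (map val v) =1 permfun w -> word_perm v = w.
  by move=> E; apply: permfun_inj => x; rewrite word_permE E.
split=> [[ew minu]|[ru eu]].
  have eu : act (map val u) =1 permfun w by move=> x; rewrite -ew word_permE.
  split=> //; apply: (min_red rU) => [x|]; first by rewrite eu eU.
  have [v ev] := lift_word ltU; rewrite -ev !size_map; apply: minu.
  by apply: wordE => x; rewrite ev.
split=> [|v ev]; first exact: wordE.
rewrite -(size_map val u) -(size_map val v); apply: red_min => // x.
by rewrite -word_permE ev eu.
Qed.

Lemma reduced_exists w : exists u, reduced w u.
Proof.
have [U [rU eU ltU]] := red_exists (permfun_permle w).
have [u eu] := lift_word ltU; exists u; apply/reducedE; rewrite eu; split=> // x.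
Qed.

Lemma comm_equiv_perm u v : comm_equiv u v -> perm_eq u v.
Proof.
elim=> {u v} [u v [x y i j _]|u //|u v t _ IH1 _ IH2]; last exact: perm_trans IH1 IH2.
by rewrite perm_cat2l; apply/seq.permP => a /=; lia.
Qed.

Lemma fc_perm w u v : fully_commutative w -> reduced w u -> reduced w v -> perm_eq u v.
Proof. by move=> fc ru rv; apply/comm_equiv_perm/fc. Qed.

(** The word stays reduced after the replacement, and all reduced words of a fully commutative
    permutation have the same multiset of letters. *)
Lemma fc_replace w u x y a b : fully_commutative w -> reduced w u ->
  map val u = x ++ a ++ y -> act a =1 act b -> size b <= size a -> perm_eq a b.
Proof.
move=> fc ru eu eab sab; have [redu actu] := (reducedE w u).1 ru.
have eW : act (x ++ b ++ y) =1 act (map val u).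
  by move=> z; rewrite eu !act_cat eab.
have rW : red (x ++ b ++ y).
  by apply: min_red redu eW _; rewrite eu !size_cat; lia.
have ltW : all (fun i => i < n) (x ++ b ++ y).
  apply: red_lt => //; have [h1 h2] := permfun_permle w.
  by split=> [|z /h2 E]; [exact: act_inj|rewrite eW actu].
have [v ev] := lift_word ltW.
have rv : reduced w v by apply/reducedE; rewrite ev; split=> // z; rewrite eW actu.
have := perm_map val (fc_perm fc ru rv).
by rewrite eu ev perm_cat2l perm_cat2r.
Qed.

Lemma fc_supp w u c : fully_commutative w -> reduced w u -> (c \in supp w) = (c \in u).
Proof.
move=> fc ru; rewrite inE; apply/asboolP/idP => [[v rv cv]|cu]; last by exists u.
by rewrite (perm_mem (fc_perm fc ru rv)).
Qed.

Lemma count_shift_lt (c p : nat) a : c < p -> count_mem c (shift p a) = 0.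
Proof. by move=> lt; apply/count_memPn/negP => /mapP[i _ e]; lia. Qed.

Lemma count_ltW (c p : nat) a : p <= c -> all (fun i => i < p) a -> count_mem c a = 0.
Proof. by move=> le lta; apply/count_memPn/negP => /(allP lta); lia. Qed.

(* If one of the neighbours of c did not occur between two consecutive c's, the
   word would multiply out like a braid cluster and the two words for the glued
   permutation would contain different numbers of c's. *)
Lemma fc_gap w u : fully_commutative w -> reduced w u -> gap (map val u).
Proof.
move=> fc ru x c z y eu nz; have [redu _] := (reducedE w u).1 ru.
have [m ltz] := words_bounded z.
pose M := c.+1 + m.
have ltM : all (fun i => i < M) (c :: z).
  by rewrite /= /M; apply/andP; split; [|apply: sub_all ltz => i]; lia.
have notfix : ~ (act z c = c /\ act z c.+1 = c.+1).
  by case=> h1; move: redu; rewrite eu => /red_not_fix /(_ h1).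
have eu' : map val u = x ++ (c :: z ++ [:: c]) ++ y by rewrite eu /= -catA.
have two : count_mem c (c :: z ++ [:: c]) = 2.
  by rewrite /= count_cat /= eqxx (count_memPn nz).
split.
  apply: contrapT => noe; have fz : free c z.
    apply/allP => i iz; apply/andP; split; first by apply: contraNneq nz => e; rewrite -e.
    by apply/eqP => ei; apply: noe; exists i.
  have nb : all (fun i => i.+1 != c.+1) z by apply: sub_all fz => i; lia.
  have [z1 z2 z3] := act_split_below nb.
  have zc := free_act fz.
  have V0 : act (high c.+1 z) 0 <> 0.
    by move=> V0; apply: notfix; split=> //; rewrite z2 // subnn V0 addn0.
  have e0 : act (c :: z ++ [:: c]) =1 glue c.+1 (act (low c.+1 (c :: z))) (act (high c.+1 z)).
    by have := @glue_word_below c c.+1 [::] z [::] erefl isT fz isT; rewrite cats0 => /(_ V0).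
  have ltU : all (fun i => i < c.+1) (low c.+1 (c :: z)) by apply: filter_all.
  have lc : low c.+1 (c :: z) = c :: low c.+1 z by rewrite /low /= ltnSn.
  have gl : glueable c.+1 (M - c.+1) (act (low c.+1 (c :: z))) (act (high c.+1 z)).
    apply: glueable_words => //; [by case/andP: ltM|by rewrite /M; lia|].
    rewrite lc /= (_ : sw c c.+1 = c); last by swlia.
    by rewrite -(z1 c (ltnSn c)).1 zc; lia.
  (* In the word obtained here [c] occurs only inside [low c.+1 (c :: z)], hence once, against twice
     in the original factor. *)
  have [a [b [rab eab eX]]] := glue_word_right gl ltU.
  have sab : size (a ++ 0 :: b) <= size (high c.+1 z) by apply: red_min rab _ => t; rewrite eab.
  have /seq.permP/(_ (pred1 c)) := fc_replace fc ru eu' (fun t => etrans (e0 t) (esym (eX t))) ltac:(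
    move: sab; rewrite lc !(size_cat, size_map) /= ?(size_cat, size_map) /=;
    have := size_low_high c.+1 z; rewrite size_map; lia).
  rewrite two lc !count_cat /= ?count_cat /= !count_shift_lt // eqxx gtn_eqF //.
  rewrite (_ : count_mem c (low _ _) = 0) //; apply/count_memPn.
  by rewrite mem_filter negb_and nz orbT.
apply: contraT => nz1; exfalso; have fz : free c.+1 z.
  by apply/allP => i iz; apply/andP; split; [apply: contraNneq nz1 => e|apply: contraNneq nz => -[e]]; rewrite -e.
have nb : all (fun i => i != c) z by apply: sub_all fz => i; lia.
have [z1 z2 z3] := act_split_above nb.
have zc := free_act fz.
have U0 : act (low c z) c <> c.
  by move=> U0; apply: notfix; split=> //; rewrite (z1 c (leqnn c)).1 U0.
have hc : high c (c :: z) = 0 :: high c z by rewrite /high /= leqnn /= subnn.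
have h1 : act (high c z) 1 = 1 by have := (z2 c.+1 (ltnSn c)).1; rewrite zc subSnn; lia.
have e0 : act (c :: z ++ [:: c]) =1 glue c (act (low c z)) (act (high c (c :: z))).
  by have := @glue_word_above c [::] z [::] isT fz isT; rewrite /= cats0; apply.
have gl : glueable c (M - c) (act (low c z)) (act (high c (c :: z))).
  by apply: glueable_words => //; [rewrite /M; lia|rewrite hc /= h1].
(* Here the letter [c] comes only from the shifted [high c (c :: z)], whose single 0 is the leading
   one. *)
have [s [a [b [sp rab eab eX]]]] := glue_word_left gl.
have ltab : all (fun i => i < c) (a ++ s :: b).
  by apply: red_lt => //; case: gl => -[h2 h3] _ _ _; split=> [|t /h3]; [exact: act_inj|rewrite eab].
have sab : size (a ++ s :: b) <= size (low c z) by apply: red_min rab _ => t; rewrite eab.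
have /seq.permP/(_ (pred1 c)) := fc_replace fc ru eu' (fun t => etrans (e0 t) (esym (eX t))) ltac:(
  move: sab; rewrite hc !(size_cat, size_map) /= ?(size_cat, size_map) /=;
  have := size_low_high c z; rewrite size_map; lia).
have := count_ltW (leqnn c) ltab; rewrite two hc !count_cat /= ?count_cat /= count_shift // subnn /=.
rewrite (_ : count_mem 0 (high c z) = 0); first by lia.
by apply/count_memPn/negP => /mapP[i]; rewrite mem_filter => /andP[le_ci /(allP nb)]; lia.
Qed.

(** * Orders of products of two generators *)

Lemma gen_adjacent (i j : 'I_n) : (gen i * gen j == gen j * gen i)%g = far i j.
Proof.
have w2 (a b : 'I_n) : (gen a * gen b)%g = word_perm [:: a; b].
  by rewrite /word_perm !big_cons big_nil mulg1.
apply/eqP/idP => [|fij].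
  rewrite !w2 => /(congr1 permfun) E.
  have := congr1 (fun f => f (minn i j)) E; rewrite !word_permE /=.
  have aux a : sw a.+1 (sw a a) <> sw a (sw a.+1 a) by swlia.
  apply: contra_eqT; rewrite /far negb_and !negbK => /orP[] /eqP <-.
    by rewrite (minn_idPl (leqnSn i)); apply/eqP/aux.
  by rewrite (minn_idPr (leqnSn j)) eq_sym; apply/eqP/aux.
by apply: permfun_inj => x; rewrite !w2 !word_permE /= act_swap.
Qed.

Lemma gen_order2 (i j : 'I_n) : ((gen i * gen j) ^+ 2 = 1)%g <-> far i j.
Proof.
have g2 (a : 'I_n) : (gen a * gen a = 1)%g by apply: tperm2.
rewrite -gen_adjacent expgS expg1 mulgA; split=> [E|/eqP E].
  apply/eqP/(mulIg (gen i * gen j)%g); rewrite mulgA E.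
  by rewrite -mulgA (mulgA (gen i)) g2 mul1g g2.
by rewrite -(mulgA (gen i * gen j)%g) {2}E mulgA -(mulgA (gen i)) g2 mulg1 g2.
Qed.

Lemma gen_inj : injective (@gen n).
Proof.
move=> i j E; apply/val_inj/eqP; apply: contraT => nij.
have := congr1 (fun w : 'S_n.+1 => val (w (widen_ord (leqnSn n) i))) E.
by rewrite /= !val_gen /=; move: nij; swlia.
Qed.

Lemma gen_order3 (i j : 'I_n) : ((gen i * gen j) ^+ 3 = 1)%g <-> i = j \/ ~~ far i j.
Proof.
have g2 (a : 'I_n) : (gen a * gen a = 1)%g by apply: tperm2.
have [->|nij] := eqVneq i j; first by split=> _; [left|rewrite g2 expg1n].
have [fij|nfij] := boolP (far i j).
  split=> [|[/eqP|//]]; last by rewrite (negPf nij).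
  rewrite expgSr (gen_order2 i j).2 // mul1g => E; move: nij.
  by rewrite -(inj_eq gen_inj) -(inj_eq (mulIg (gen j))) E g2 eqxx.
split=> _; first by right.
have braid : (gen i * gen j * gen i = gen j * gen i * gen j)%g.
  have w3 (a b c : 'I_n) : (gen a * gen b * gen c)%g = word_perm [:: a; b; c].
    by rewrite /word_perm !big_cons big_nil mulg1 mulgA.
  apply: permfun_inj => x; rewrite !w3 !word_permE /=; move: nfij nij.
  by rewrite -val_eqE /far /=; swlia.
rewrite 2!expgSr expg1 !mulgA -(mulgA _ (gen j) (gen i)) -(mulgA _ _ (gen j)) -braid.
by rewrite !mulgA -(mulgA _ (gen i) (gen i)) g2 mulg1 -(mulgA _ (gen j) (gen j)) g2 mulg1 g2.
Qed.
End Words.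

(** * Heaps and factors of words *)

(** [R a c] holds whenever [a] precedes [c] in [t], so the hypothesis on [s] makes every pair listed
    in the opposite order commute. The letters of [t] are brought to the front of [s] one by one. *)
Lemma reorder (T : eqType) (lab : T -> nat) (R : rel T) (s t : seq T) :
  perm_eq s t -> pairwise R t -> pairwise (fun c a => far (lab c) (lab a) || ~~ R a c) s ->
  act (map lab s) =1 act (map lab t).
Proof.
elim: t s => [|a t IHt] s st; first by move/perm_size/size0nil: st => ->.
rewrite pairwise_cons => /andP[Rat Rt] Hs.
have : a \in s by rewrite (perm_mem st) inE eqxx.
move=> /splitPr as_; case: as_ st Hs => A B st.
have {}st : perm_eq (A ++ B) t.
  by move: st; rewrite -cat1s perm_catCA /= perm_cons.
rewrite pairwise_cat pairwise_cons allrel_consr => /and3P[/andP[HA HAB] pA /andP[_ pB]].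
have E := IHt _ st Rt; rewrite pairwise_cat HAB pA pB in E.
have fA : all (far (lab a)) (map lab A).
  rewrite all_map; apply/allP => c cA /=.
  have := allP HA c cA; rewrite (allP Rat) ?orbF; first by rewrite /far andbC.
  by rewrite -(perm_mem st) mem_cat cA.
move=> x; rewrite /= -E // !map_cat /=.
exact: (act_far_mid [::]).
Qed.

Section Heap.
Variable n : nat.
Implicit Types (u v : seq 'I_n).

Lemma heap_relE u (a b : 'I_(size u)) : heap_rel a b = (a < b) && ~~ far (label a) (label b).
Proof. by rewrite /heap_rel gen_adjacent. Qed.

Lemma heap_le_leq u (a b : 'I_(size u)) : heap_le a b -> a <= b.
Proof.
case/connectP => p; elim: p a => [|c p IHp] a /=; first by move=> _ ->.
case/andP=> /andP[lt_ac _] cp eb; exact: leq_trans (ltnW lt_ac) (IHp _ cp eb).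
Qed.

Lemma heap_lt_ltn u (a b : 'I_(size u)) : heap_lt a b -> a < b.
Proof. by case/andP=> nab /heap_le_leq; rewrite ltn_neqAle nab. Qed.

Lemma heap_lt_trans u (a b c : 'I_(size u)) : heap_lt a b -> heap_lt b c -> heap_lt a c.
Proof.
move=> ab bc; apply/andP; split.
  by rewrite -val_eqE neq_ltn (ltn_trans (heap_lt_ltn ab) (heap_lt_ltn bc)).
by case/andP: ab => _ ab; case/andP: bc => _; apply: connect_trans.
Qed.

Lemma pairwise_enum m : pairwise (fun a b : 'I_m => a < b) (enum 'I_m).
Proof.
rewrite -(pairwise_map val ltn) val_enum_ord; have := iota_ltn_sorted 0 m.
by rewrite sorted_pairwise //; apply: ltn_trans.
Qed.

Lemma map_label u : map (fun a : 'I_(size u) => label a) (enum 'I_(size u)) = u.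
Proof. exact: (map_tnth_enum (in_tuple u)). Qed.

Lemma convex_factor v u : convex_subheap v u -> exists x y,
  size u = size (x ++ v ++ y) /\ act (map val u) =1 act (map val (x ++ v ++ y)).
Proof.
case=> phi [phi_inj phi_lab phi_le phi_conv].
pose img (a : 'I_(size u)) := a \in codom phi.
pose up (a : 'I_(size u)) := [exists j, heap_lt (phi j) a].
pose s := enum 'I_(size u).
(* [X] also takes the elements incomparable with the image. Nothing in [V] or [Y] lies below an
   element of [X], and by convexity nothing in [Y] lies below an element of [V]; so [X ++ V ++ Y] is
   a linear extension of the heap. *)
pose X := [seq a <- s | ~~ img a && ~~ up a].
pose Y := [seq a <- s | ~~ img a && up a].
pose V := map phi (enum 'I_(size v)).
have phi_lt a b : heap_lt (phi a) (phi b) = heap_lt a b.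
  by rewrite /heap_lt phi_le (inj_eq phi_inj).
have mem_img a : img a = (a \in V) by rewrite /img codomE.
have uV : uniq V by rewrite map_inj_uniq ?enum_uniq.
have uX : uniq X by apply/filter_uniq/enum_uniq.
have uY : uniq Y by apply/filter_uniq/enum_uniq.
have memX a : (a \in X) = ~~ img a && ~~ up a by rewrite mem_filter mem_enum andbT.
have memY a : (a \in Y) = ~~ img a && up a by rewrite mem_filter mem_enum andbT.
have stX : perm_eq s (X ++ V ++ Y).
  apply: uniq_perm; first exact: enum_uniq.
    rewrite !cat_uniq uV uX uY /= andbT; apply/andP; split; apply/hasPn => a.
      by rewrite mem_cat -mem_img memY /= memX => /orP[->//|/andP[-> ->]].
    by rewrite memY -mem_img => /andP[].
  move=> a; rewrite !mem_cat memX memY -mem_img mem_enum inE.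
  by case: (img a); case: (up a).
have E := @reorder _ (fun a => val (label a)) (fun a c => ~~ heap_lt c a) s (X ++ V ++ Y) stX.
exists (map (fun a => label a) X), (map (fun a => label a) Y).
have labV : map (fun a => label a) V = v.
  by rewrite -[RHS]map_label -map_comp; apply: eq_map => a /=; rewrite phi_lab.
rewrite -labV -!map_cat; split.
  by rewrite size_map -(perm_size stX) size_enum_ord.
have eu : map val u = map (fun a => val (label a)) s.
  by rewrite (map_comp val) /s map_label.
have eXVY : map val (map (fun a => label a) (X ++ V ++ Y)) = map (fun a => val (label a)) (X ++ V ++ Y).
  by elim: (X ++ V ++ Y) => //= a l ->.
rewrite eu eXVY; apply: (E _ _); last first.
  apply: sub_pairwise (pairwise_enum _) => c a lt_ca; rewrite negbK -implyNb.
  apply/implyP => nf; apply/andP; split; first by rewrite -val_eqE neq_ltn lt_ca.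
  by apply: connect1; rewrite heap_relE lt_ca.
have asc p : pairwise (fun a c : 'I_(size u) => ~~ heap_lt c a) (filter p s).
  apply: pairwise_filter; apply: sub_pairwise (pairwise_enum _) => a c lt_ac.
  by apply/negP => /heap_lt_ltn; lia.
have upT a c : up a -> heap_lt a c -> up c.
  by case/existsP=> j ja ac; apply/existsP; exists j; apply: heap_lt_trans ac.
rewrite !pairwise_cat !asc /= andbT; apply/and3P; split.
- apply/allrelP => a c; rewrite memX => /andP[na nu].
  rewrite mem_cat => /orP[/mapP[j _ ->]|].
    by apply: contra nu => lt; apply/existsP; exists j.
  rewrite memY => /andP[_ uc]; apply: contra nu; exact: upT.
- apply/allrelP => a c /mapP[j _ ->]; rewrite memY => /andP[nc /existsP[i ic]].
  apply/negP => cj; have [k ck] := phi_conv _ _ _ ic cj.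
  by case/negP: nc; rewrite ck; apply: codom_f.
- rewrite pairwise_map; apply: sub_pairwise (pairwise_enum _) => a c lt_ac.
  by rewrite /= phi_lt; apply/negP => /heap_lt_ltn; lia.
Qed.

Lemma factor_convex x v y : convex_subheap v (x ++ v ++ y).
Proof.
have ltp (a : 'I_(size v)) : size x + a < size (x ++ v ++ y).
  by have := ltn_ord a; rewrite !size_cat; lia.
pose phi a := Ordinal (ltp a).
have lab a : label (phi a) = label a.
  have x0 := label a; rewrite /label !(tnth_nth x0) /= nth_cat ltnNge leq_addr addKn /=.
  by rewrite nth_cat ltn_ord.
have phiP (c : 'I_(size (x ++ v ++ y))) (a b : 'I_(size v)) : phi a <= c -> c <= phi b ->
    exists k, c = phi k.
  move=> /= h1 h2; have lt : c - size x < size v by have := ltn_ord b; lia.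
  by exists (Ordinal lt); apply: val_inj => /=; lia.
have rel a b : heap_rel (phi a) (phi b) = heap_rel a b.
  by rewrite !heap_relE !lab /= ltn_add2l.
exists phi; split=> //.
- by move=> a b /(congr1 val) /= E; apply: val_inj => /=; lia.
- move=> a b; apply/idP/idP => [|/connectP[p]].
    case/connectP=> p; elim: p a => [|c p IHp] a /=.
      move=> _ /(congr1 val) /= E; have -> : a = b by apply: val_inj => /=; lia.
      exact: connect0.
    case/andP=> ac cp eb; have cb : heap_le c (phi b) by apply/connectP; exists p.
    have [|k ek] := @phiP c a b _ (heap_le_leq cb); first by case/andP: ac => /ltnW.
    move: ac cp eb; rewrite ek rel => ak cp eb.
    exact: connect_trans (connect1 ak) (IHp k cp eb).
  elim: p a => [|c p IHp] a /=; first by move=> _ ->; apply: connect0.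
  case/andP=> ac cp eb; apply: connect_trans (IHp c cp eb).
  by apply: connect1; rewrite rel.
- move=> a b c /heap_lt_ltn h1 /heap_lt_ltn h2.
  by apply: (@phiP c a b); apply: ltnW.
Qed.
End Heap.

Lemma gap_unshift d v : gap (shift d v) -> gap v.
Proof.
move=> gv x c z y E nc; have [||[e ez eE] cz] := gv (shift d x) (d + c) (shift d z) (shift d y).
- by rewrite E /shift map_cat /= map_cat.
- by rewrite mem_map //; apply: addnI.
split.
  by case/mapP: ez => i iz ei; exists i => //; lia.
by case/mapP: cz => i iz ei; rewrite (_ : c.+1 = i) //; lia.
Qed.

Lemma card_column n (u : seq 'I_n) c : #|column u c| = count_mem c u.
Proof.
transitivity (count (pred1 c) (map (fun a : 'I_(size u) => label a) (enum 'I_(size u)))).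
  rewrite -sum1_card -sum1_count big_map big_enum_cond.
  by apply: eq_bigl => a; rewrite !inE.
by rewrite map_label.
Qed.

(** The condition for m = 3 sends adjacent generators to equal or adjacent ones, and monotonicity
    leaves only the next generator. *)
Lemma embedding_shift k n (i j : 'I_k) (f : 'I_k -> 'I_n) :
  coxeter_embedding (gen_interval i j) f ->
  forall c, c \in gen_interval i j -> f c = f i + (c - i) :> nat.
Proof.
case=> f_inj f_m f_lt c; have [m] := ubnP (c - i); elim: m c => // m IHm c lt_m.
rewrite inE => /andP[le_ic le_cj].
have [ec|nc] := eqVneq c i; first by rewrite ec subnn addn0.
have lt_ic : i < c by rewrite ltn_neqAle eq_sym (inj_eq val_inj) nc.
have lt_c1 : c.-1 < k by apply: leq_ltn_trans (leq_pred _) (ltn_ord c).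
pose c' := Ordinal lt_c1.
have cD : c \in gen_interval i j by rewrite inE le_ic.
have c'D : c' \in gen_interval i j by rewrite inE /=; lia.
have IH : f c' = f i + (c' - i) :> nat by apply: IHm => //=; lia.
have lt_f : f c' < f c by apply: f_lt => //=; lia.
have nf : ~~ far c' c by rewrite /far /= prednK ?eqxx //; lia.
have /(gen_order3 _ _).1 [E|] := (f_m 3 (or_intror erefl) c' c c'D cD).1
    ((gen_order3 _ _).2 (or_intror nf)).
  by move: lt_f; rewrite E ltnn.
by move: IH lt_f; rewrite /far /=; lia.
Qed.

Lemma red_square s u : ~ red (s :: s :: u).
Proof.
have -> : s :: s :: u = [::] ++ s :: [::] ++ s :: u by [].
by move/red_not_fix; apply.
Qed.

Section HeapWords.
Variable H : {fset {k : nat & 'S_k.+1}}.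

(** The lowest column is normalised to 0; by [embedding_shift] an embedding of the support is a
    translation, the [d] of [contains]. *)
Definition heap_word v := exists2 h, h \in H & exists (i j : 'I_(tag h)) u,
  [/\ i <= j, supp (tagged h) = gen_interval i j, reduced (tagged h) u &
      v = [seq val c - i | c <- u]].

Hypothesis H_conn : forall h, h \in H -> connected (tagged h).
Hypothesis H_fc : forall h, h \in H -> fully_commutative (tagged h).
Hypothesis H_int : forall h, h \in H -> two_in_internal_columns (tagged h).
Hypothesis H_two : (exists2 h, h \in H & #|supp (tagged h)| = 2) ->
                   (exists2 h, h \in H & #|supp (tagged h)| = 1).

Lemma heap_word_letters h (i j : 'I_(tag h)) u : h \in H ->
  supp (tagged h) = gen_interval i j -> reduced (tagged h) u ->
  forall c, (c \in u) = (i <= c <= j).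
Proof. by move=> hH eD ru c; rewrite -(fc_supp c (H_fc hH) ru) eD inE. Qed.

Lemma shift_word k (i : 'I_k) d (u : seq 'I_k) (f : 'I_k -> nat) :
  (forall c, c \in u -> f c = d + (c - i)) -> shift d [seq val c - i | c <- u] = map f u.
Proof. by move=> E; rewrite /shift -map_comp; apply/eq_in_map => c /E->. Qed.

Lemma heap_word_good : good_set heap_word.
Proof.
have [[h hH c1]|no1] := EM (exists2 h, h \in H & #|supp (tagged h)| = 1); [left|right].
  have [i [j [le_ij eD]]] := H_conn hH.
  have [u ru] := reduced_exists (tagged h).
  have letters := heap_word_letters hH eD ru.
  have eij : i = j.
    have /eqP/cards1P[c ec] := c1.
    have := in_set1 i c; have := in_set1 j c.
    by rewrite -ec eD !inE le_ij !leqnn => /esym/eqP-> /esym/eqP->.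
  exists h => //; exists i, j, u; split=> //.
  have [redu _] := (reducedE _ _).1 ru.
  have all_i c : c \in u -> c = i.
    by rewrite letters -eij -eqn_leq => /eqP/val_inj.
  have : i \in u by rewrite letters le_ij leqnn.
  case: u ru letters redu all_i => [|a [|b u]] //= _ _ redu all_i _.
    by rewrite (all_i a) ?inE ?eqxx // subnn.
  have ea : a = i by apply: all_i; rewrite inE eqxx.
  have eb : b = i by apply: all_i; rewrite !inE eqxx orbT.
  by case: (@red_square i (map val u)); move: redu; rewrite ea eb.
move=> v [h hH [i [j [u [le_ij eD ru ->]]]]].
have letters := heap_word_letters hH eD ru.
(* Without a single generator in [H], [H_two] excludes two-column supports, so there is an internal
   column, as [good_word] requires. *)
have no2 : #|supp (tagged h)| <> 2 by move=> E; apply/no1/H_two; exists h.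
have big : 1 < j - i.
  rewrite ltnNge; apply/negP; rewrite leq_eqVlt ltnS leqn0 => /orP[] /eqP E.
    apply: no2; rewrite eD (_ : gen_interval i j = [set i; j]) ?cards2.
      by have -> : i != j by apply/eqP => e; move: E; rewrite e subnn.
    by apply/setP => c; rewrite !inE -!(inj_eq (@ord_inj _)); move: E le_ij; clear; lia.
  apply: no1; exists h => //; rewrite eD (_ : gen_interval i j = [set i]) ?cards1 //.
  by apply/setP => c; rewrite !inE -!(inj_eq (@ord_inj _)); move: E le_ij; clear; lia.
exists (j - i); split=> //.
- by rewrite all_map; apply/allP => c; rewrite letters /=; lia.
- move=> c /andP[c0 cb].
  have lt_c : i + c < tag h by apply: leq_ltn_trans (ltn_ord j); lia.
  have in_c : i < Ordinal lt_c < j by move: c0 cb; clear => /=; lia.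
  have := H_int hH le_ij eD ru in_c; rewrite card_column => /leq_trans; apply.
  by rewrite count_map; apply: sub_count => x /= /eqP-> /=; rewrite addKn.
- apply: (@gap_unshift i); rewrite (@shift_word _ i i u val); first exact: fc_gap (H_fc hH) ru.
  by move=> c; rewrite letters => /andP[/subnKC->].
Qed.

Lemma contains_heap_word n (w : 'S_n.+1) :
  contains heap_word (permfun w) <-> exists2 h, h \in H & heap_contains w (tagged h).
Proof.
split=> [[v' [x [y [d [[h hH [i [j [v [le_ij eD rv ->]]]]] rW eW]]]]]|].
  have letters := heap_word_letters hH eD rv.
  have ltW : all (fun c => c < n) (x ++ shift d [seq val c - i | c <- v] ++ y).
    by apply: red_lt => //; have [_ h2] := permfun_permle w; split=> [|z /h2 E];
       [exact: act_inj|rewrite eW].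
  move: (ltW); rewrite !all_cat => /and3P[/lift_word[x0 ex] lts /lift_word[y0 ey]].
  have ltv (c : 'I_(tag h)) : i <= c <= j -> d + (c - i) < n.
    by rewrite -letters => cv; apply: (allP lts); rewrite /shift -map_comp; apply/mapP; exists c.
  have lt_d : d < n by rewrite -[d]addn0 -(subnn i); apply: ltv; rewrite leqnn.
  (* The default of [insubd] is irrelevant: the embedding is only tested on the support of [h]. *)
  pose f (c : 'I_(tag h)) := insubd (Ordinal lt_d) (d + (c - i)) : 'I_n.
  have fE (c : 'I_(tag h)) : i <= c <= j -> f c = d + (c - i) :> nat by move=> /ltv; rewrite /f val_insubd => ->.
  have eu : map val (x0 ++ map f v ++ y0) = x ++ shift d [seq val c - i | c <- v] ++ y.
    rewrite !map_cat ex ey (@shift_word _ i d v (val \o f)) => [|c]; first by rewrite (map_comp val f).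
    by rewrite letters => /fE.
  exists h => //; exists (x0 ++ map f v ++ y0), v, f; split=> //.
  - by apply/reducedE; rewrite eu; split.
  - rewrite eD; have farE a b : a \in gen_interval i j -> b \in gen_interval i j ->
        far (f a) (f b) = far a b /\ (f a = f b <-> a = b).
      rewrite !inE => ha hb; have := fE _ ha; have := fE _ hb; rewrite /far => -> ->.
      split; first by lia.
      split=> [E|->//]; have : f a = f b :> nat by rewrite E.
      by rewrite !fE // => E'; apply: val_inj; move: E' ha hb => /=; clear; lia.
    split=> [a b ha hb E|m m23 a b ha hb|a b ha hb lt].
    + exact: (farE a b ha hb).2.1.
    + have [E1 E2] := farE a b ha hb.
      by case: m23 => ->; rewrite ?gen_order2 ?gen_order3 E1 ?E2.
    + by move: ha hb; rewrite !inE => ha hb; rewrite !fE //; lia.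
  - exact: factor_convex.
case=> h hH [u [v [f [ru rv emb conv]]]].
have [i [j [le_ij eD]]] := H_conn hH.
have letters := heap_word_letters hH eD rv.
have [x [y [szu eu]]] := convex_factor conv.
have [redu actu] := (reducedE _ _).1 ru.
have ew : map val (x ++ map f v ++ y) = map val x ++ shift (f i) [seq val c - i | c <- v] ++ map val y.
  rewrite !map_cat (@shift_word _ i (f i) v (val \o f)) => [|c cv]; first by rewrite (map_comp val f).
  by apply: (@embedding_shift _ _ i j); rewrite -?eD // eD inE -letters.
exists [seq val c - i | c <- v], (map val x), (map val y), (f i); rewrite -ew; split.
- by exists h => //; exists i, j, v.
- by apply: min_red redu (fsym eu) _; rewrite !size_map szu.
- by move=> z; rewrite -eu actu.
Qed.
End HeapWords.

(** * Patterns *)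

Section Patterns.
Variables (n : nat) (w : 'S_n.+1).
Local Notation f := (permfun w).

Lemma patternP p : pattern_contains w p <-> exists g : nat -> nat,
  (forall i j, i < j < size p -> g i < g j) /\
  (forall i, i < size p -> g i <= n) /\
  (forall i j, i < size p -> j < size p -> (nth 0 p i < nth 0 p j) = (f (g i) < f (g j))).
Proof.
split.
  case/existsP=> g /forallP gP.
  have gPP a b := andP (forallP (gP a) b).
  pose G i := if insub i is Some a then val (g a) else 0.
  have GE i (lt : i < size p) : G i = g (Ordinal lt) by rewrite /G insubT.
  exists G; split; [|split].
  - move=> i j /andP[lt_ij lt_j]; have lt_i := ltn_trans lt_ij lt_j.
    rewrite !GE; by have [/implyP/(_ lt_ij)] := gPP (Ordinal lt_i) (Ordinal lt_j).
  - by move=> i lt_i; rewrite GE -ltnS.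
  - move=> i j lt_i lt_j; rewrite !GE !permfun_ord.
    by have [_ /eqP] := gPP (Ordinal lt_i) (Ordinal lt_j).
case=> g [g_lt [g_le g_rel]]; apply/existsP.
exists [ffun a : 'I_(size p) => inord (g a)]; apply/forallP => a; apply/forallP => b.
have ga := g_le a (ltn_ord a); have gb := g_le b (ltn_ord b).
rewrite !ffunE !inordK //; apply/andP; split.
  by apply/implyP => lt; apply: g_lt; rewrite lt ltn_ord.
by rewrite g_rel // -!permfun_ord !inordK.
Qed.

Lemma pattern4 p0 p1 p2 p3 a b c d : a < b -> b < c -> c < d -> d <= n ->
  (forall i j, i < 4 -> j < 4 -> (nth 0 [:: p0; p1; p2; p3] i < nth 0 [:: p0; p1; p2; p3] j) =
     (nth 0 [:: f a; f b; f c; f d] i < nth 0 [:: f a; f b; f c; f d] j)) ->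
  pattern_contains w [:: p0; p1; p2; p3].
Proof.
move=> ab bc cd dn E; apply/patternP; exists (nth 0 [:: a; b; c; d]).
by split; [|split]; [case=> [|[|[|[|i]]]] [|[|[|[|j]]]] //=; lia
  |case=> [|[|[|[|i]]]] //=; lia
  |move=> i j li lj; rewrite E //; case: i li {E} => [|[|[|[|i]]]] // _; case: j lj => [|[|[|[|j]]]]].
Qed.

Lemma inv_le x y : inv f x y -> y <= n.
Proof.
have [_ fix_f] := permfun_permle w; have := permle_lt x (permfun_permle w).
rewrite leqNgt /inv => E /andP[lt_xy lt_f]; apply/negP => lt_ny.
by move: E lt_f; rewrite (fix_f y) //; have := fix_f x; lia.
Qed.

Lemma no321P : ~~ pattern_contains w [:: 3; 2; 1] <-> no321 f.
Proof.
split=> [/negP np a b c ab bc|no].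
  apply/np/patternP; have := inv_le ab; have := inv_le bc; move: ab bc; rewrite /inv => ab bc le1 le2.
  exists (nth 0 [:: a; b; c]); split; [|split].
  - by case=> [|[|[|i]]] [|[|[|j]]] //=; lia.
  - by case=> [|[|[|i]]] //=; lia.
  - by case=> [|[|[|i]]] [|[|[|j]]] //= _ _; lia.
apply/negP => /patternP[g [g_lt [_ g_rel]]]; apply: (no (g 0) (g 1) (g 2)); rewrite /inv.
  by have := g_lt 0 1 isT; have := g_rel 1 0 isT isT => /= <-; lia.
by have := g_lt 1 2 isT; have := g_rel 2 1 isT isT => /= <-; lia.
Qed.

Definition avoid3 := [&& ~~ pattern_contains w [:: 3; 4; 2; 1],
  ~~ pattern_contains w [:: 4; 3; 1; 2] & ~~ pattern_contains w [:: 4; 3; 2; 1]].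

Ltac pat4 := case=> [|[|[|[|?]]]] [|[|[|[|?]]]] //= _ _; lia.

Lemma avoid3P : avoid3 <-> clustered f.
Proof.
have f_inj := (permfun_permle w).1.
split=> [/and3P[/negP n1 /negP n2 /negP n3] a b c ab bc|cl].
  (* Two larger entries before [b], followed by [b] and [c], form 3421 or 4321. Likewise [a] and
     [b], followed by two entries smaller than that at [b], form 4312 or 4321. *)
  have left2 x y : inv f x b -> inv f y b -> x < y -> False.
    move=> xb yb lt_xy; have := inv_le bc; have := f_inj x y; move: xb yb bc; rewrite /inv => xb yb bc nxy le_c.
    have [lt|le] := ltnP (f x) (f y).
      by apply/n1/(@pattern4 _ _ _ _ x y b c); [lia..|pat4].
    by apply/n3/(@pattern4 _ _ _ _ x y b c); [lia..|pat4].
  have right2 x y : inv f b x -> inv f b y -> x < y -> False.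
    move=> bx b_y lt_xy; have := inv_le b_y; have := f_inj x y; move: bx b_y ab; rewrite /inv => bx b_y ab nxy le_y.
    have [lt|le] := ltnP (f x) (f y).
      by apply/n2/(@pattern4 _ _ _ _ a b x y); [lia..|pat4].
    by apply/n3/(@pattern4 _ _ _ _ a b x y); [lia..|pat4].
  split=> // x ix.
    by case: (ltngtP x a) => // lt; [case: (left2 _ _ ix ab lt)|case: (left2 _ _ ab ix lt)].
  by case: (ltngtP x c) => // lt; [case: (right2 _ _ ix bc lt)|case: (right2 _ _ bc ix lt)].
apply/and3P; split; apply/negP => /patternP[g [g_lt [_ g_rel]]];
  have l01 := g_lt 0 1 isT; have l12 := g_lt 1 2 isT; have l23 := g_lt 2 3 isT;
  have l02 := g_lt 0 2 isT; have l13 := g_lt 1 3 isT;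
  have r10 := g_rel 1 0 isT isT; have r20 := g_rel 2 0 isT isT; have r21 := g_rel 2 1 isT isT;
  have r31 := g_rel 3 1 isT isT; have r32 := g_rel 3 2 isT isT; rewrite /= in r10 r20 r21 r31 r32.
- have [_ _ u _] := cl (g 0) (g 2) (g 3) ltac:(by rewrite /inv; lia) ltac:(by rewrite /inv; lia).
  by have := u (g 1) ltac:(by rewrite /inv; lia); lia.
- have [_ _ _ u] := cl (g 0) (g 1) (g 2) ltac:(by rewrite /inv; lia) ltac:(by rewrite /inv; lia).
  by have := u (g 3) ltac:(by rewrite /inv; lia); lia.
- have [_ _ u _] := cl (g 0) (g 2) (g 3) ltac:(by rewrite /inv; lia) ltac:(by rewrite /inv; lia).
  by have := u (g 1) ltac:(by rewrite /inv; lia); lia.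
Qed.

(** Adjacent pivots are fixed points and form the 23 of a 4231 pattern. Conversely, the two middle
    entries of such a pattern are pivots with the same larger and smaller entries; uniqueness forces
    the entry right after the first to have its value between theirs, so it is a pivot too. *)
Lemma avoid4231P : clustered f ->
  ~~ pattern_contains w [:: 4; 2; 3; 1] <-> forall q, pivot f q -> ~ pivot f q.+1.
Proof.
move=> cl; have pf := permfun_permle w; split=> [/negP np q piv piv1|no].
  have eq := pivot_fix pf piv; have eq1 := pivot_fix pf piv1.
  have [l [r [il ir _ _]]] := piv; have := inv_le ir; move: il ir; rewrite /inv eq => il ir le_r.
  have nl : f l <> q.+1 by rewrite -[q.+1]eq1 => /pf.1; lia.
  have nr : r <> q.+1 by move=> e; move: ir; rewrite e eq1; lia.
  by apply/np/(@pattern4 _ _ _ _ l q q.+1 r); rewrite ?eq ?eq1; [lia..|pat4].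
apply/negP => /patternP[g [g_lt [_ g_rel]]].
have [a [b [c [d [ab bc cd [h1 h2 h3]]]]]] : exists a b c d, [/\ a < b, b < c, c < d &
    [/\ f d < f b, f b < f c & f c < f a]].
  exists (g 0), (g 1), (g 2), (g 3).
  have := g_lt 0 1 isT; have := g_lt 1 2 isT; have := g_lt 2 3 isT.
  have := g_rel 3 1 isT isT; have := g_rel 1 2 isT isT; have := g_rel 2 0 isT isT.
  by move=> /= <- <- <-; split=> //; lia.
have mid x : b <= x -> x <= c -> f b <= f x -> f x <= f c -> pivot_with f x a d.
  by move=> *; apply: cl; rewrite /inv; lia.
have pvb := mid b (leqnn _) (ltnW bc) (leqnn _) (ltnW h2).
have pvc := mid c (ltnW bc) (leqnn _) (ltnW h2) (leqnn _).
have [_ _ ub1 ub2] := pvb; have [_ _ uc1 uc2] := pvc.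
have low : f b <= f b.+1.
  rewrite leqNgt; apply/negP => lt; have := ub2 b.+1; rewrite /inv ltnSn lt => /(_ isT); lia.
have high : f b.+1 <= f c.
  rewrite leqNgt; apply/negP => lt.
  have lt_c : b.+1 < c by rewrite ltn_neqAle bc andbT; apply/eqP => e; move: lt; rewrite e ltnn.
  by have := uc1 b.+1; rewrite /inv lt lt_c => /(_ isT); lia.
apply: (no b); first by exists a, d.
by exists a, d; apply: mid.
Qed.
End Patterns.

(** * Counting *)

(** Bijections are given as relations because the permutation belonging to a function on nat is only
    known to exist. *)
Lemma card_rel (S T : finType) (A : {set S}) (B : {set T}) (R : S -> T -> Prop) :
  (forall a, a \in A -> exists2 b, b \in B & R a b) ->
  (forall b, b \in B -> exists2 a, a \in A & R a b) ->
  (forall a b b', R a b -> R a b' -> b = b') ->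
  (forall a a' b, R a b -> R a' b -> a = a') -> #|A| = #|B|.
Proof.
move=> RA RB Rfun Rinj.
have le (S1 T1 : finType) (A1 : {set S1}) (B1 : {set T1}) (R1 : S1 -> T1 -> Prop) :
    (forall a, a \in A1 -> exists2 b, b \in B1 & R1 a b) ->
    (forall a a' b, R1 a b -> R1 a' b -> a = a') -> #|A1| <= #|B1|.
  move=> RA1 Rinj1.
  have [->|[a0 a0A]] := set_0Vmem A1; first by rewrite cards0.
  have [b0 _ _] := RA1 a0 a0A.
  pose g a := if pselect (exists2 b, b \in B1 & R1 a b) is left e then s2val (cid2 e) else b0.
  have gP a : a \in A1 -> g a \in B1 /\ R1 a (g a).
    by move=> /RA1 e; rewrite /g; case: pselect => // e'; case: (cid2 e').
  rewrite -(@card_in_imset _ _ g A1) => [|a a' /gP[_ r] /gP[_ r'] E].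
    by apply/subset_leq_card/subsetP => _ /imsetP[a /gP[gB _] ->].
  by apply: Rinj1 r _; rewrite E.
apply/eqP; rewrite eqn_leq (le _ _ _ _ R) //=.
by apply: (le _ _ _ _ (fun b a => R a b)) => // b b' a; apply: Rfun.
Qed.

Lemma permfun_onto n f : permle n f -> exists w : 'S_n.+1, permfun w = f.
Proof.
move=> pf; have [W [rW eW ltW]] := red_exists pf; have [u eu] := lift_word ltW.
by exists (word_perm u); apply/funext => x; rewrite word_permE eu.
Qed.

Lemma permfun_eq n (w w' : 'S_n.+1) : permfun w = permfun w' -> w = w'.
Proof. by move=> E; apply: permfun_inj => x; rewrite E. Qed.

Section Count.
Implicit Types (Q X Y Z : nat -> (nat -> nat) -> Prop).

Definition perms Q n : {set 'S_n.+1} := [set w | `[< Q n (permfun w) >]].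

Definition card_perms Q n := #|perms Q n|.

Lemma in_perms Q n w : reflect (Q n (permfun w)) (w \in perms Q n).
Proof. by rewrite inE; apply: asboolP. Qed.

Lemma eq_count_perms Y Z n : (forall f, permle n f -> Y n f <-> Z n f) -> card_perms Y n = card_perms Z n.
Proof.
move=> E; apply: eq_card => w; apply/in_perms/in_perms; apply E; exact: permfun_permle.
Qed.

Lemma count_split Q (R : nat -> (nat -> nat) -> Prop) n :
  card_perms Q n = card_perms (fun n f => Q n f /\ R n f) n + card_perms (fun n f => Q n f /\ ~ R n f) n.
Proof.
rewrite /card_perms -(cardsID [set w | `[< R n (permfun w) >]] (perms Q n)).
congr (_ + _); apply: eq_card => w; rewrite !inE.
  by rewrite asbool_and.
by rewrite asbool_and andbC asbool_neg.
Qed.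

(** A permutation fixing the last point and its restriction are the same function on nat. *)
Lemma count_fix_last (C : (nat -> nat) -> Prop) n :
  card_perms (fun n f => C f /\ f n = n) n.+1 = card_perms (fun _ => C) n.
Proof.
apply: (card_rel (R := fun w w' => permfun w = permfun w')).
- move=> w /in_perms[Cw fw].
  have [inj_w fix_w] := permfun_permle w.
  have pw : permle n (permfun w).
    split=> // x; rewrite leq_eqVlt => /predU1P[<-//|]; exact: fix_w.
  have [w' ew'] := permfun_onto pw.
  by exists w' => //; apply/in_perms; rewrite ew'.
- move=> w /in_perms Cw; have pw : permle n.+1 (permfun w).
    by apply: permleW (permfun_permle w).
  have [w' ew'] := permfun_onto pw; exists w' => //; apply/in_perms.
  by rewrite ew'; split=> //; apply: (permfun_permle w).2.
- by move=> a b b' -> /permfun_eq.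
- by move=> a a' b <- /permfun_eq.
Qed.

Definition shift_fun (f : nat -> nat) x := if x is y.+1 then (f y).+1 else 0.

Lemma shift_fun_inj : injective shift_fun.
Proof. by move=> f g E; apply/funext => x; have := congr1 (@^~ x.+1) E => -[]. Qed.

Lemma count_fix_first (C : (nat -> nat) -> Prop) n :
  (forall f, C (shift_fun f) <-> C f) ->
  card_perms (fun _ f => C f /\ f 0 = 0) n.+1 = card_perms (fun _ => C) n.
Proof.
move=> Cshift; apply/esym; apply: (card_rel (R := fun w w' => permfun w' = shift_fun (permfun w))).
- move=> w /in_perms Cw; have [inj_w fix_w] := permfun_permle w.
  have pw : permle n.+1 (shift_fun (permfun w)).
    by split=> [[|x] [|y] //= [/inj_w->]//|[|x] //= /fix_w->].
  have [w' ew'] := permfun_onto pw; exists w' => //; apply/in_perms.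
  by rewrite ew'; split=> //; apply/Cshift.
- move=> w /in_perms[Cw w0]; have [inj_w fix_w] := permfun_permle w.
  pose f x := (permfun w x.+1).-1.
  have pos x : 0 < permfun w x.+1.
    by rewrite lt0n; apply/eqP; rewrite -[RHS]w0 => /inj_w.
  have fE : permfun w = shift_fun f.
    by apply/funext => -[|x] //=; rewrite /f prednK.
  have pf : permle n f.
    split=> [x y E|x lt_x]; last by rewrite /f fix_w.
    by have := inj_w x.+1 y.+1; rewrite fE /= E => /(_ erefl) [].
  have [w' ew'] := permfun_onto pf; exists w'; last by rewrite ew'.
  by apply/in_perms; rewrite ew'; apply/Cshift; rewrite -fE.
- by move=> a b b' <- /permfun_eq.
- by move=> a a' b -> /shift_fun_inj/permfun_eq.
Qed.

(** As members of [X p] have no pivot, [p] is the first pivot of their gluings. So the classes [B p]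
    are disjoint from each other and from [Z], and [glue_inj] counts each of them as a product. *)
Lemma count_glue X Q Y Z n :
  (forall f, permle n f -> Y n f <-> Z n f \/ exists p u v,
     [/\ p <= n, X p u, Q (n - p) v, glueable p (n - p) u v & f = glue p u v]) ->
  (forall f q, Z n f -> ~ pivot f q) ->
  (forall p u q, X p u -> ~ pivot u q) ->
  (forall p u, X p u -> u p <> p) -> (forall m v, Q m v -> v 0 <> 0) ->
  card_perms Y n = card_perms Z n + \sum_(p < n.+1) card_perms X p * card_perms Q (n - p).
Proof.
move=> YE Zpiv Xpiv Xp Q0.
pose B p : {set 'S_n.+1} := [set w | `[< exists u v,
  [/\ X p u, Q (n - p) v, glueable p (n - p) u v & permfun w = glue p u v] >]].
have BP p w : reflect (exists u v,
  [/\ X p u, Q (n - p) v, glueable p (n - p) u v & permfun w = glue p u v]) (w \in B p).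
  by rewrite inE; apply: asboolP.
have cardB (p : 'I_n.+1) : #|B p| = card_perms X p * card_perms Q (n - p).
  have le_pn : p <= n by rewrite -ltnS.
  rewrite /card_perms -cardsX; apply/esym.
  apply: (card_rel (R := fun uv w => glueable p (n - p) (permfun uv.1) (permfun uv.2) /\
                                     permfun w = glue p (permfun uv.1) (permfun uv.2))).
  - case=> u v /setXP[/in_perms Xu /in_perms Qv] /=.
    have gl : glueable p (n - p) (permfun u) (permfun v).
      by split; [exact: permfun_permle|exact: Xp|exact: permfun_permle|exact: Q0 Qv].
    have := glue_permle gl; rewrite subnKC // => /permfun_onto[w ew].
    by exists w => //; apply/BP; exists (permfun u), (permfun v).
  - move=> w /BP[u [v [Xu Qv gl ew]]]; have [pu _ pv _] := gl.
    have [u' eu'] := permfun_onto pu; have [v' ev'] := permfun_onto pv.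
    exists (u', v'); last by rewrite /= eu' ev'.
    by apply/setXP; split; apply/in_perms; rewrite ?eu' ?ev'.
  - by move=> uv w w' [_ <-] [_ /permfun_eq].
  - move=> [u v] [u' v'] w /= [gl E] [gl' E'].
    have [|eu ev] := glue_inj gl gl'; first by move=> x; rewrite -E -E'.
    by rewrite (permfun_inj eu) (permfun_inj ev).
have B_first p w : w \in B p -> pivot (permfun w) p /\ forall q, q < p -> ~ pivot (permfun w) q.
  case/BP=> u [v [Xu _ gl ->]]; split; first exact: pivot_glue gl.
  by move=> q lt_qp; rewrite (pivot_glue_left gl lt_qp); apply: Xpiv Xu.
have one w : (w \in perms Y n : nat) = (w \in perms Z n) + \sum_(p < n.+1) (w \in B p).
  have [Zw|nZ] := boolP (w \in perms Z n).
    have /in_perms Zw' := Zw.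
    rewrite big1 => [|p _]; last first.
      by apply/eqP; rewrite eqb0; apply/negP => /B_first[/(Zpiv _ _ Zw')].
    by apply/eqP; rewrite eqb1; apply/in_perms/(YE _ (permfun_permle w)); left.
  have [Yw|nY] := boolP (w \in perms Y n).
    have /in_perms Yw' := Yw; have [Zw|[p [u [v [le_pn Xu Qv gl ew]]]]] := (YE _ (permfun_permle w)).1 Yw'.
      by case/in_perms: nZ.
    have Bp : w \in B p by apply/BP; exists u, v.
    rewrite (bigD1 (Ordinal (le_pn : p < n.+1))) //= Bp big1 // => q nq.
    apply/eqP; rewrite eqb0; apply/negP => Bq; case/eqP: nq; apply: val_inj => /=.
    have [piv_p first_p] := B_first _ _ Bp; have [piv_q first_q] := B_first _ _ Bq.
    by case: (ltngtP q p) => // [/first_p|/first_q].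
  rewrite big1 // => p _; apply/eqP; rewrite eqb0; apply/negP => /BP[u [v [Xu Qv gl ew]]].
  case/in_perms: nY; apply/(YE _ (permfun_permle w)); right; exists p, u, v.
  by rewrite -ltnS ltn_ord.
under eq_bigr do rewrite -cardB.
have cardE' (A : {set 'S_n.+1}) : #|A| = \sum_(w : 'S_n.+1) (w \in A).
  by rewrite -sum1_card big_mkcond.
rewrite /card_perms !cardE' (eq_bigr _ (fun w _ => one w)) big_split /=; congr (_ + _).
by rewrite exchange_big; apply: eq_bigr => p _; rewrite cardE'.
Qed.
End Count.

(** * Shifting a permutation by one point *)

Lemma no321_shift f : no321 (shift_fun f) <-> no321 f.
Proof.
split=> nf a b c; last first.
  case: a b c => [|a] [|b] [|c]; rewrite /inv //= !ltnS; exact: nf.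
by move=> ab bc; apply: (nf a.+1 b.+1 c.+1).
Qed.

Lemma act_shift W : act (shift 1 W) = shift_fun (act W).
Proof.
apply/funext; elim: W => [|i W IHW] x; first by case: x.
have e : sw (1 + i) x = shift_fun (sw i) x by case: x => [|x]; rewrite /sw /=; repeat case: ifP; lia.
by rewrite -[LHS]/(act (shift 1 W) (sw (1 + i) x)) IHW e; case: x {e}.
Qed.

Lemma red_shift W : red (shift 1 W) = red W.
Proof. by elim: W => //= i W ->; rewrite act_shift. Qed.

Lemma contains_shift (P : seq nat -> Prop) f : (forall v, P v -> 0 \in v) ->
  contains P (shift_fun f) <-> contains P f.
Proof.
move=> P0; split=> [] [v [x [y [d [Pv rW eW]]]]].
  set W := x ++ _ in rW eW.
  have geW : all (leq 1) W.
    by apply: red_ge => // -[|//] _; rewrite eW.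
  have down u : all (leq 1) u -> u = shift 1 (map predn u).
    by elim: u => //= i u IHu /andP[gt_i /IHu <-]; rewrite add1n prednK.
  (* As 0 is a letter of [v], [d] is a letter of [W], and [W] has only positive letters because it
     fixes 0. *)
  have gt_d : 0 < d.
    apply: (allP geW); rewrite !mem_cat; apply/orP; right; apply/orP; left.
    by apply/mapP; exists 0; rewrite ?addn0 //; apply: P0.
  have eW1 : W = shift 1 (map predn x ++ shift d.-1 v ++ map predn y).
    move: geW; rewrite /W !all_cat => /and3P[/down ex _ /down ey].
    have ed : shift d v = shift 1 (shift d.-1 v).
      by rewrite /shift -map_comp; apply: eq_map => i /=; move: gt_d; clear; lia.
    by rewrite {1}ex {1}ey ed /shift !map_cat.
  exists v, (map predn x), (map predn y), d.-1; split=> //.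
    by rewrite -red_shift -eW1.
  move=> z; have := eW z.+1; rewrite eW1 act_shift => -[]; exact.
exists v, (shift 1 x), (shift 1 y), d.+1.
have -> : shift 1 x ++ shift d.+1 v ++ shift 1 y = shift 1 (x ++ shift d v ++ y).
  by rewrite /shift !map_cat -map_comp.
by rewrite red_shift act_shift; split=> // -[|z] //=; rewrite eW.
Qed.

(** * Recurrences by the first pivot *)

Section Recurrence.
Variable P : seq nat -> Prop.
Hypotheses (goodP : good_set P) (P0 : forall v, P v -> 0 \in v).

Definition tri (f : nat -> nat) := no321 f /\ ~ contains P f.
Definition clus (far_apart : bool) (f : nat -> nat) :=
  [/\ clustered f, ~ contains P f & far_apart -> forall q, pivot f q -> ~ pivot f q.+1].

(** A suffix [L] means that the last point moves, [F] that the first does. [triM] drops the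
    transposition when pivots may not be adjacent. In [clusF] the point 0 stands for the pivot of a
    gluing, so a pivot at 1 would be adjacent to it. *)
Definition triL n f := tri f /\ f n <> n.
Definition triF (n : nat) f := tri f /\ f 0 <> 0.
Definition triFL n f := triF n f /\ f n <> n.
Definition triM (far_apart : bool) n f := triFL n f /\ (far_apart -> n <> 1).
Definition clusF (far_apart : bool) (n : nat) f :=
  [/\ clus far_apart f, f 0 <> 0 & far_apart -> ~ pivot f 1].

Lemma tri_shift f : tri (shift_fun f) <-> tri f.
Proof. by rewrite /tri no321_shift contains_shift. Qed.

Lemma count_triL n : card_perms (fun=> tri) n.+1 = card_perms (fun=> tri) n + card_perms triL n.+1.
Proof. by rewrite (count_split _ (fun n f => f n = n)) count_fix_last. Qed.

Lemma count_triF n : card_perms (fun=> tri) n.+1 = card_perms (fun=> tri) n + card_perms triF n.+1.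
Proof. by rewrite (count_split _ (fun _ f => f 0 = 0)) (count_fix_first _ tri_shift). Qed.

Lemma count_triFL n : card_perms triF n.+1 = card_perms triF n + card_perms triFL n.+1.
Proof.
by rewrite (count_split _ (fun n f => f n = n)) (count_fix_last (fun f => tri f /\ f 0 <> 0)).
Qed.

Lemma permle0 f : permle 0 f -> f 0 = 0.
Proof. by move=> pf; have := permle_lt 0 pf; lia. Qed.

Lemma count0 (Q : nat -> (nat -> nat) -> Prop) :
  (forall f, f 0 = 0 -> ~ Q 0 f) -> card_perms Q 0 = 0.
Proof.
move=> nQ; apply/eqP; rewrite cards_eq0; apply/eqP/setP => w; rewrite [RHS]inE.
by apply/negP => /in_perms; apply/nQ/permle0/permfun_permle.
Qed.

Lemma count_triM n (b : bool) : ~ (b /\ n = 1) -> card_perms (triM b) n = card_perms triFL n.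
Proof. by move=> nb1; apply: eq_count_perms => f _; split=> [[]|tf]; last by split=> // hb e; apply: nb1; split. Qed.

Lemma count_triM1 : card_perms (triM true) 1 = 0.
Proof.
apply/eqP; rewrite cards_eq0; apply/eqP/setP => w; rewrite [RHS]inE.
by apply/negP => /in_perms[_ /(_ isT)].
Qed.

Lemma pivot_gt0 f : ~ pivot f 0.
Proof. by case=> l [r [/andP[]]]. Qed.

Lemma first_pivot f q : pivot f q -> exists2 p, pivot f p & forall q, q < p -> ~ pivot f q.
Proof.
move=> pq; have ex : exists p, `[< pivot f p >] by exists q; apply/asboolP.
case: (ex_minnP ex) => p /asboolP pp minp; exists p => // r lt_rp /asboolP /minp; lia.
Qed.

Lemma glue_clus b p m u v : glueable p m u v ->
  clus b (glue p u v) /\ (forall q, q < p -> ~ pivot (glue p u v) q) <->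
  tri u /\ clusF b m v.
Proof.
move=> gl; have [pu up pv v0] := gl; have Hc := glue_clustered gl; have Hk := contains_glue goodP gl.
have right q : pivot (glue p u v) (p + q.+1) <-> pivot v q.+1 by apply: (pivot_glue_right gl).
split=> [[[cw kw bw] fw]|[[nu ku] [[cv kv bv] _ b1]]].
  have [nu cv] := Hc.1 (conj cw fw); split; first by split=> // ku; apply/kw/Hk; left.
  split=> [|//|hb].
    split=> // [kv|hb [|q] pq pq1]; [by apply/kw/Hk; right|exact: pivot_gt0 pq|].
    by apply: (bw hb (p + q.+1)); rewrite -?addnS right.
  by rewrite -right addn1; apply: (bw hb); apply: pivot_glue gl.
have [cw fw] := Hc.2 (conj nu cv); split=> //; split=> // [/Hk[]//|hb q pq pq1].
case: (ltngtP q p) => [/fw//|lt|e].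
  have [r er] : exists r, q = p + r.+1 by exists (q - p).-1; move: lt; clear; lia.
  by move: pq pq1; rewrite er -addnS !right; apply: bv.
by move: pq1; rewrite e -[p.+1]addn1 right; apply: b1.
Qed.

Lemma tri_clus b f : (forall q, ~ pivot f q) -> clus b f <-> tri f.
Proof.
move=> np; split=> [[cf kf _]|[nf kf]].
  by split=> //; apply: clustered_no321.
by split=> //; exact: no321_clustered.
Qed.

Lemma count_clus b n : card_perms (fun=> clus b) n =
  card_perms (fun=> tri) n + \sum_(p < n.+1) card_perms triL p * card_perms (clusF b) (n - p).
Proof.
apply: count_glue => [f pf|f q []|p u q [[]]|p u []|m v []//] //; last 2 first.
- by move=> nf _; apply: no321_pivot.
- by move=> nf _ _; apply: no321_pivot.
split=> [cf|[[nf kf]|[p [u [v [le_pn [tu up] Qv gl ->]]]]]].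
- have [[q pq]|np] := EM (exists q, pivot f q).
    have [p pp first] := first_pivot pq; right.
    have [le_pn [u [v [gl /funext ef]]]] := pivot_glueP pf pp; rewrite ef in cf first.
    have [tu Qv] := (glue_clus b gl).1 (conj cf first).
    by exists p, u, v; split=> //; split=> //; case: gl.
  by left; apply/(tri_clus b) => // q pq; apply: np; exists q.
- by apply/tri_clus => // q; apply: no321_pivot.
- by have [] := (glue_clus b gl).2 (conj tu Qv).
Qed.

Lemma glue0 p m u v : glueable p m u v -> glue p u v 0 = 0 <-> u 0 = 0.
Proof.
move=> [pu up _ v0]; have p0 : 0 < p.
  by rewrite lt0n; apply/eqP => e; apply: up; rewrite e in pu *; apply: permle0.
by rewrite /glue p0; case: eqP => // ->; move: p0 v0; clear; lia.
Qed.

Lemma glue_pivot1 p m u v : glueable p m u v -> no321 u -> pivot (glue p u v) 1 <-> p = 1.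
Proof.
move=> gl nu; have piv := pivot_glue gl; split=> [p1|<-//].
case: (ltngtP p 1) => // [|lt]; first by case: p gl piv p1 => // gl /pivot_gt0.
by case: (no321_pivot nu ((pivot_glue_left gl lt).1 p1)).
Qed.

(** The left part [u] inherits the condition at 0 by [glue0], and a pivot at 1 means [p = 1], the
    case removed by [triM]. *)
Lemma count_clusF b n : card_perms (clusF b) n =
  card_perms triF n + \sum_(p < n.+1) card_perms (triM b) p * card_perms (clusF b) (n - p).
Proof.
apply: count_glue => [f pf|f q [[nf _] _]|p u q [[[[nf _] _] _] _]|p u [[]]|m v []//] //;
  try exact: no321_pivot.
split=> [[cf f0 f1]|[[[nf kf] f0]|[p [u [v [le_pn [[[tu u0] up] bp] Qv gl ->]]]]]].
- have [[q pq]|np] := EM (exists q, pivot f q).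
    have [p pp first] := first_pivot pq; right.
    have [le_pn [u [v [gl /funext ef]]]] := pivot_glueP pf pp; rewrite ef in cf first f0 f1.
    have [tu Qv] := (glue_clus b gl).1 (conj cf first).
    exists p, u, v; split=> //; split; first split; first split=> //.
    + by rewrite -(glue0 gl).
    + by case: gl.
    + by move=> hb e; apply: (f1 hb); apply/(glue_pivot1 gl tu.1).
  by left; split=> //; apply/(tri_clus b) => // q pq; apply: np; exists q.
- split=> // [|_]; last exact: no321_pivot.
  by apply/tri_clus => // q; apply: no321_pivot.
- have [cw _] := (glue_clus b gl).2 (conj tu Qv); split=> //; first by rewrite (glue0 gl).
  by move=> hb /(glue_pivot1 gl tu.1) /(bp hb).
Qed.
End Recurrence.

(** * The transposition and the single generator *)

Section TwoStrands.
Variable P : seq nat -> Prop.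
Hypotheses (goodP : good_set P) (P0 : forall v, P v -> 0 \in v).

Lemma permle_sw0 : permle 1 (sw 0).
Proof. by split=> [|x]; [exact: sw_inj|swlia]. Qed.

Lemma permle1 f : permle 1 f -> f 0 <> 0 -> f = sw 0.
Proof.
move=> pf f0; apply/funext => -[|[|x]]; last exact: pf.2.
  by have := permle_lt 0 pf; rewrite /sw /=; move: f0; clear; lia.
have := permle_lt 0 pf; have := permle_lt 1 pf; have := pf.1 0 1.
by rewrite /sw /=; move: f0; clear; lia.
Qed.

Lemma no321_sw0 : no321 (sw 0).
Proof.
by move=> a b c; rewrite /inv /sw; clear; repeat case: eqP; lia.
Qed.

Lemma contains_sw0 : contains P (sw 0) -> P [:: 0].
Proof.
case=> v [x [y [d [Pv rW eW]]]].
have : size (x ++ shift d v ++ y) <= size [:: 0] by apply: red_min => // z; rewrite eW.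
have := P0 Pv; rewrite !size_cat size_map; case: v Pv {rW eW} => [|a [|b v]] //= Pv.
  by rewrite inE => /eqP a0 _; move: Pv; rewrite -a0.
by move=> _; clear; lia.
Qed.

Lemma count_triFL1 : ~ contains P (sw 0) -> card_perms (triFL P) 1 = 1.
Proof.
move=> nc; have [w0 ew0] := permfun_onto permle_sw0.
rewrite /card_perms (_ : perms _ _ = [set w0]) ?cards1 //.
apply/setP => w; rewrite [RHS]inE; apply/in_perms/eqP => [[[_ f0] _]|->].
  by apply/permfun_eq; rewrite ew0; apply: permle1 => //; apply: permfun_permle.
rewrite ew0; split=> //; split=> //; split=> //; exact: no321_sw0.
Qed.

Lemma count_triL0 n : P [:: 0] -> card_perms (triL P) n = 0.
Proof.
move=> P00; apply/eqP; rewrite cards_eq0; apply/eqP/setP => w; rewrite [RHS]inE.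
apply/negP => /in_perms[[_ nc] fn].
by apply: nc; apply: contains_nontrivial P00 (permfun_permle w) fn.
Qed.
End TwoStrands.

(** * Generating functions *)

Import GRing.Theory.
Local Open Scope ring_scope.

Definition ser (c : nat -> nat) : fps rat := Fps (fun n => (c n)%:R).

Lemma serM (a b c : nat -> nat) :
  (forall n, c n = (\sum_(i < n.+1) a i * b (n - i))%N) -> ser c = ser a * ser b.
Proof.
move=> E; apply: fpsP => n /=; rewrite E natr_sum.
by apply: eq_bigr => i _; rewrite natrM.
Qed.

Lemma serD (a b c : nat -> nat) : (forall n, c n = a n + b n)%N -> ser c = ser a + ser b.
Proof. by move=> E; apply: fpsP => n /=; rewrite E natrD. Qed.

Lemma fps_addE (f g : fps rat) n : (f + g) n = f n + g n.
Proof. by []. Qed.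

Lemma fps_oppE (f : fps rat) n : (- f) n = - f n.
Proof. by []. Qed.

Lemma fps_mulX (f : fps rat) n : (fps_X rat * f) n = if n is m.+1 then f m else 0.
Proof.
case: n => [|n] /=; first by rewrite big_ord1 mul0r.
rewrite big_ord_recl /= mul0r add0r big_ord_recl /= mul1r subSS subn0.
by rewrite big1 ?addr0 // => i _; rewrite mul0r.
Qed.

Lemma geometric (F L K Q G : fps rat) : 1 - K \is a GRing.unit ->
  Q = L + K * Q -> G = F + L * Q -> G = F + L ^+ 2 / (1 - K).
Proof.
move=> uK eQ ->; congr (_ + _); apply: (mulIr uK); rewrite divrK //.
by rewrite expr2 -mulrA; congr (_ * _); rewrite mulrBr mulr1 mulrC {1}eQ addrK.
Qed.

Lemma enumeration (P : seq nat -> Prop) (F : fps rat) :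
  good_set P -> (forall v, P v -> 0%N \in v) ->
  F = ser (card_perms (fun=> tri P)) -> F 0%N = 1 ->
  let x := fps_X rat in let L := F - x * F - 1 in
  let M := F - 2%:R * x * F + x ^+ 2 * F - 1 in
  ser (card_perms (fun=> clus P true)) = F + L ^+ 2 / (1 - M) /\
  ser (card_perms (fun=> clus P false)) = F + L ^+ 2 / (1 - x - M).
Proof.
move=> goodP P0 eF F0 x L M.
(* The permutations fixing the chosen end contribute [x * ser a], and the constant [c] corrects
   degree 0, where no permutation moves an end. *)
have first_order (a b : nat -> nat) c : b 0 = 0%N -> (a 0%N)%:R = c ->
    (forall n, a n.+1 = a n + b n.+1)%N -> ser b = ser a - x * ser a - Fps (fun n => c *+ (n == 0%N)).
  move=> b0 a0 aS; apply: fpsP => -[|n]; rewrite !(fps_addE, fps_oppE) fps_mulX.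
    by rewrite /= b0 a0 subr0 mulr1n subrr.
  by rewrite /= aS natrD mulr0n subr0 addrC addKr.
have one_fps : Fps (fun n => 1 *+ (n == 0%N)) = 1 :> fps rat by apply: fpsP => n.
have zero_fps : Fps (fun n => 0 *+ (n == 0%N)) = 0 :> fps rat.
  by apply: fpsP => n /=; rewrite mul0rn.
have tri0 : (card_perms (fun=> tri P) 0)%:R = 1 :> rat by move: F0; rewrite eF.
have eL : ser (card_perms (triL P)) = L.
  rewrite (first_order _ _ 1 _ tri0) ?one_fps -?eF //; first by apply: count0 => f f0 [_ /(_ f0)].
  exact: count_triL.
have triF0 : card_perms (triF P) 0 = 0%N by apply: count0 => f f0 [_ /(_ f0)].
have eL' : ser (card_perms (triF P)) = L.
  rewrite (first_order _ _ 1 _ tri0) ?one_fps -?eF // => n.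
  exact: count_triF.
have eK : ser (card_perms (triFL P)) = M + x.
  (* The constant 1 subtracted in [L] becomes [1 - x], whence the [x] in addition to [M]. *)
  rewrite (first_order (card_perms (triF P)) _ 0) ?zero_fps ?triF0 ?eL' //; last exact: count_triFL.
    by rewrite subr0 /L /M; ring.
  by apply: count0 => f f0 [[_ /(_ f0)]].
have eQ b : ser (card_perms (clusF P b)) = L + ser (card_perms (triM P b)) * ser (card_perms (clusF P b)).
  rewrite -{1}eL' -(@serM _ _ (fun n => \sum_(i < n.+1) card_perms (triM P b) i * card_perms (clusF P b) (n - i)))%N //.
  by apply: serD => n; apply: count_clusF.
have eG b : ser (card_perms (fun=> clus P b)) = F + L * ser (card_perms (clusF P b)).
  rewrite -eL -(@serM _ _ (fun n => \sum_(i < n.+1) card_perms (triL P) i * card_perms (clusF P b) (n - i)))%N //.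
  by rewrite eF; apply: serD => n; apply: count_clus.
have mul0 (f g : fps rat) : (f * g) 0%N = f 0%N * g 0%N by rewrite /= big_ord1.
have x0 : x 0%N = 0 by [].
have M0 : M 0%N = 0.
  rewrite /M !(fps_addE, fps_oppE, mul0) x0 !(mulr0, mul0r, subr0, addr0) F0.
  by rewrite subrr.
have unitM (y : fps rat) : y 0%N = 0 -> 1 - (M + y) \is a GRing.unit.
  move=> y0; have -> : (1 - (M + y) \is a GRing.unit) = (1 - (M 0%N + y 0%N) != 0) by [].
  by rewrite M0 y0 addr0.
(* If the transposition is forbidden, it cannot account for the term [x] between [triFL] and [triM];
   but then [P] contains the single generator, [L = 0], and both formulas reduce to [F]. *)
have [nc|/contrapT c0] := EM (~ contains P (sw 0)); last first.
  have L0 : L = 0.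
    rewrite -eL; apply: fpsP => n /=; rewrite count_triL0 //; exact: contains_sw0.
  by rewrite !eG L0 !mul0r expr2 !mul0r !addr0.
have eMx : ser (card_perms (triM P true)) = M.
  apply: (addIr x); rewrite -eK; apply: fpsP => n; rewrite fps_addE /=.
  have [->|n1] := eqVneq n 1%N; first by rewrite count_triM1 (count_triFL1 nc) add0r.
  by rewrite addr0 count_triM // => -[_ /eqP]; rewrite (negPf n1).
have eMf : ser (card_perms (triM P false)) = M + x.
  by rewrite -eK; apply: fpsP => n /=; rewrite count_triM // => -[].
split.
  apply: geometric (eG true); first by rewrite -[M]addr0 unitM.
  by rewrite {1}eQ eMx.
rewrite -addrA -opprD addrC [x + M]addrC addrC; apply: geometric (eG false); first exact: unitM.
by rewrite {1}eQ eMf.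
Qed.

(** * Return to heap avoidance and one-line patterns *)

Lemma heap_word0 (H : {fset {k : nat & 'S_k.+1}}) :
  (forall h, h \in H -> fully_commutative (tagged h)) -> forall v, heap_word H v -> 0 \in v.
Proof.
move=> fcH v [h hH [i [j [u [le_ij eD ru ->]]]]].
apply/mapP; exists i; last by rewrite subnn.
by rewrite (heap_word_letters fcH hH eD ru) leqnn le_ij.
Qed.

Section Avoid.
Variable H : {fset {k : nat & 'S_k.+1}}.
Hypothesis H_conn : forall h, h \in H -> connected (tagged h).
Hypothesis H_fc : forall h, h \in H -> fully_commutative (tagged h).
Local Notation P := (heap_word H).

Lemma in_S_avoid ps n (w : 'S_n.+1) : reflect
  (all (fun p => ~~ pattern_contains w p) ps /\ ~ contains P (permfun w)) (w \in S_avoid ps H n).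
Proof.
rewrite inE; apply: (iffP andP) => -[-> avH]; split=> //.
  by move/(contains_heap_word H_conn H_fc) => [h hH]; apply: (asboolP _ avH).
by apply/asboolP => h hH hw; apply/avH/(contains_heap_word H_conn H_fc); exists h.
Qed.

Lemma gf_avoid_count ps (C : (nat -> nat) -> Prop) :
  (forall n (w : 'S_n.+1), all (fun p => ~~ pattern_contains w p) ps /\ ~ contains P (permfun w) <->
     C (permfun w)) -> gf_avoid ps H = ser (card_perms (fun=> C)).
Proof.
move=> E; apply: fpsP => n /=; congr (_%:R)%R; apply: eq_card => w.
by apply/in_S_avoid/in_perms; apply E.
Qed.

Lemma gf_no321 : gf_avoid [:: [:: 3; 2; 1]] H = ser (card_perms (fun=> tri P)).
Proof. by apply: gf_avoid_count => n w; rewrite /= andbT no321P. Qed.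

(** These are the maximally clustered permutations. *)
Lemma gf_clustered :
  gf_avoid [:: [:: 3; 4; 2; 1]; [:: 4; 3; 1; 2]; [:: 4; 3; 2; 1]] H = ser (card_perms (fun=> clus P false)).
Proof.
apply: gf_avoid_count => n w; rewrite /= andbT -/(avoid3 w) avoid3P.
by split=> [[]|[]].
Qed.

Lemma gf_freely_braided :
  gf_avoid [:: [:: 3; 4; 2; 1]; [:: 4; 2; 3; 1]; [:: 4; 3; 1; 2]; [:: 4; 3; 2; 1]] H =
  ser (card_perms (fun=> clus P true)).
Proof.
apply: gf_avoid_count => n w /=; rewrite andbT; split.
  case=> /and4P[n1 n2 n3 n4] nH; have cl : clustered (permfun w) by apply/avoid3P/and3P.
  by split=> // _; apply/(avoid4231P cl).
case=> cl nH /(_ isT) adj; split=> //.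
by have /and3P[-> -> ->] := (avoid3P w).2 cl; rewrite (avoid4231P cl).2.
Qed.
End Avoid.

Unset Implicit Arguments.
Local Close Scope ring_scope.

(* [H_two] excludes exactly the sets H for which the formulas fail because of a
   heap with two columns and hence no internal column: if H contains
   s_i s_{i+1} or s_{i+1} s_i but no single generator, then 321 in S_3 is not
   in the sets on the left, while the formulas count it (L = x + ...). *)
Theorem theorem2p4
  (H : {fset {k : nat & 'S_k.+1}})
  (H_conn : forall h, h \in H -> connected (tagged h))
  (H_fc : forall h, h \in H -> fully_commutative (tagged h))
  (H_int : forall h, h \in H -> two_in_internal_columns (tagged h))
  (H_two : (exists2 h, h \in H & #|supp (tagged h)| = 2) ->
           (exists2 h, h \in H & #|supp (tagged h)| = 1)) :
  let x : fps rat := fps_X rat in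
  let F : fps rat := gf_avoid [:: [:: 3; 2; 1]] H in
  let L : fps rat := (F - x * F - 1)%R in
  let M : fps rat := (F - 2%:R * x * F + x ^+ 2 * F - 1)%R in
  gf_avoid [:: [:: 3; 4; 2; 1]; [:: 4; 2; 3; 1]; [:: 4; 3; 1; 2]; [:: 4; 3; 2; 1]] H
    = (F + L ^+ 2 / (1 - M))%R
  /\
  gf_avoid [:: [:: 3; 4; 2; 1]; [:: 4; 3; 1; 2]; [:: 4; 3; 2; 1]] H
    = (F + L ^+ 2 / (1 - x - M))%R.
Proof.
have F0 : gf_avoid [:: [:: 3; 2; 1]] H 0 = 1%R.
  by apply: gf_avoid0 => // p; rewrite inE => /eqP->.
rewrite (gf_freely_braided H_conn H_fc) (gf_clustered H_conn H_fc).
exact: (enumeration (heap_word_good H_conn H_fc H_int H_two) (heap_word0 H_fc)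
          (gf_no321 H_conn H_fc) F0).
Qed.
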